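(* Let $Y$ be a scalar random variable and $X\in\mathbb{R}^p$ a random vector with first component $1$ and support $\mathcal{X}$. For $t\in(0,1)$ let $\beta(t)\in\arg\min_{\beta\in\mathbb{R}^p}\mathrm{E}\,\rho_t(Y-X^\top\beta)$, where $\rho_t(z)=t\max(z,0)+(1-t)\max(-z,0)$ (equivalently $\beta(t)$ minimizes $\mathrm{E}(Y-X^\top\beta)_++(1-t)\mathrm{E}X^\top\beta$), and let $A_t=1(Y>X^\top\beta(t))$. Assume (QR): $\mathrm{E}|Y|<\infty$, $\mathrm{E}\|X\|^2<\infty$, the conditional density $(y,x)\mapsto f_{Y\mid X}(y,x)$ exists and is bounded and uniformly continuous, and $\mathrm{E}(f_{Y\mid X}(X^\top\beta(t),X)XX^\top)$ has full rank for each $t\in(0,1)$. Then: (i) If $t\mapsto x^\top\beta(t)$ is increasing on $(0,1)$ for each $x\in\mathcal{X}$, then $\widetilde U:=\int_0^1A_t\,dt$ satisfies $Y=X^\top\beta(\widetilde U)$ a.s., $\widetilde U\sim U(0,1)$ and $\mathrm{E}(X\mid\widetilde U)=\mathrm{E}(X)$; moreover $\widetilde U$ solves $\max\{\mathrm{E}(VY): V\sim U(0,1),\ \mathrm{E}(X\mid V)=\mathrm{E}(X)\}$. (ii) Under the monotonicity assumption of (i), the representation is unique a.s.: if also $Y=\overline\beta(\overline U)^\top X$ with $\overline U\sim U(0,1)$, $\mathrm{E}(X\mid\overline U)=\mathrm{E}(X)$, and $u\mapsto X^\top\overline\beta(u)$ increasing in $u\in(0,1)$ a.s., then $\widetilde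 U=\overline U$ and $X^\top\beta(\widetilde U)=X^\top\overline\beta(\overline U)$ a.s. (iii) If the conditional quantile function of $Y$ given $X$ is linear, $Q_{Y\mid X}(u)=X^\top\beta_0(u)$, so that $Y=X^\top\beta_0(U)$ with $U\sim U(0,1)$ independent of $X$, then $U=\widetilde U$ and $\beta_0(U)=\beta(U)$ a.s.
   Context: $U(0,1)$ denotes the uniform distribution on $(0,1)$; $z_+=\max(z,0)$. *)

(* Defs.v *)
From HB Require Import structures.
From mathcomp Require Import all_boot all_order all_algebra.
From mathcomp Require Import all_classical all_reals all_analysis.
Set Implicit Arguments. Unset Strict Implicit. Unset Printing Implicit Defensive.
Import Order.TTheory GRing.Theory Num.Theory.
Local Open Scope classical_set_scope.
Local Open Scope ring_scope.

(* Vectors of R^p are represented as functions 'I_p -> R; a random vector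
   X : Omega -> ('I_p -> R) is given componentwise. *)
Definition dotp (R : realType) (p : nat) (x b : 'I_p -> R) : R :=
  \sum_(i < p) x i * b i.

Definition rho (R : realType) (t z : R) : R :=
  t * Num.max z 0 + (1 - t) * Num.max (- z) 0.

Definition Xbox d (Om : measurableType d) (R : realType) (p : nat)
  (X : Om -> 'I_p -> R) (C : 'I_p -> set R) : set Om :=
  [set w | forall i, C i (X w i)].

Definition random_vector d (Om : measurableType d) (R : realType) (p : nat)
  (X : Om -> 'I_p -> R) : Prop :=
  forall i, measurable_fun setT (fun w => X w i).

Definition supportX d (Om : measurableType d) (R : realType) (p : nat)
  (P : probability Om R) (X : Om -> 'I_p -> R) : set ('I_p -> R) :=
  [set x | forall e : R, 0 < e ->
     (0 < P [set w | (forall i, `|X w i - x i| < e)%R])%E].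

Definition uniform01 d (Om : measurableType d) (R : realType)
  (P : probability Om R) (V : Om -> R) : Prop :=
  measurable_fun setT V /\
  forall B : set R, measurable B ->
    P (V @^-1` B) = (@lebesgue_measure R) (B `&` `]0, 1[).

(* E(X | V) = E(X) : for every event {V in B} of sigma(V),
   E[X_i 1_{V in B}] = E[X_i] P(V in B) *)
Definition mean_indep d (Om : measurableType d) (R : realType) (p : nat)
  (P : probability Om R) (X : Om -> 'I_p -> R) (V : Om -> R) : Prop :=
  forall (B : set R) (i : 'I_p), measurable B ->
    ('E_P[fun w => (X w i * \1_(V @^-1` B) w)%R] =
     'E_P[fun w => X w i] * P (V @^-1` B))%E.

(* V independent of X (rectangles generate the Borel sets of R^p) *)
Definition indep_RV_vec d (Om : measurableType d) (R : realType) (p : nat)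
  (P : probability Om R) (V : Om -> R) (X : Om -> 'I_p -> R) : Prop :=
  forall (B : set R) (C : 'I_p -> set R), measurable B ->
    (forall i, measurable (C i)) ->
    P (V @^-1` B `&` Xbox X C) = (P (V @^-1` B) * P (Xbox X C))%E.

Definition cond_density d (Om : measurableType d) (R : realType) (p : nat)
  (P : probability Om R) (Y : Om -> R) (X : Om -> 'I_p -> R)
  (f : R -> ('I_p -> R) -> R) : Prop :=
  forall (B : set R) (C : 'I_p -> set R), measurable B ->
    (forall i, measurable (C i)) ->
    P ([set w | B (Y w)] `&` Xbox X C) =
    (\int[P]_(w in Xbox X C)
        \int[(@lebesgue_measure R)]_(y in B) (f y (X w))%:E)%E.

Definition bounded_fun2 (R : realType) (p : nat) (f : R -> ('I_p -> R) -> R)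
  : Prop := exists M : R, forall y x, `|f y x| <= M.

Definition unif_cont2 (R : realType) (p : nat) (f : R -> ('I_p -> R) -> R)
  : Prop :=
  forall e : R, 0 < e -> exists2 dl : R, 0 < dl &
    forall y y' (x x' : 'I_p -> R), `|y - y'| < dl ->
      (forall i, `|x i - x' i| < dl) -> `|f y x - f y' x'| < e.

Definition strictly_incr01 (R : realType) (g : R -> R) : Prop :=
  forall s t : R, 0 < s -> s < t -> t < 1 -> g s < g t.

Definition cond_quantile (R : realType) (p : nat)
  (f : R -> ('I_p -> R) -> R) (x : 'I_p -> R) (u : R) : R :=
  inf [set y : R | (u%:E <=
     \int[(@lebesgue_measure R)]_(s in `]-oo, y%R]) (f s x)%:E)%E].

Definition Utilde d (Om : measurableType d) (R : realType) (p : nat)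
  (Y : Om -> R) (X : Om -> 'I_p -> R) (beta : R -> 'I_p -> R) : Om -> R :=
  fun w => fine (\int[(@lebesgue_measure R)]_(t in `]0%R, 1%R[)
     (\1_[set t | dotp (X w) (beta t) < Y w] t)%:E)%E.

(* Main.v *)
(** The first order condition for [beta t], obtained by differentiating the
    expected check loss (the hyperplane [Y = X^T beta t] has probability zero
    because the conditional density is bounded), reads
    [E (X 1_{Y > X^T beta t}) = (1 - t) E X].  By convexity and the full rank
    of the Hessian it determines [beta t]: two solutions carry no mass of [Y]
    between their hyperplanes, so the density vanishes at [X^T beta t] wherever
    the hyperplanes differ.

    If [Y = X^T b V] with [V] uniform, [X] mean independent of [V] and
    [u |-> X^T b u] increasing, then [{Y > X^T b t}] and [{V > t}] coincide, so
    [b t] satisfies the first order condition: hence [b = beta], and [V] is the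
    rank [int_0^1 1_{Y > X^T beta t} dt].  This gives (ii), and also (iii) since
    a conditional quantile function with a bounded density is increasing.

    For (i), monotonicity gives [{U > t} = {Y > X^T beta t}] almost surely, so
    the first order conditions prescribe the law of [U] and the conditional
    mean of [X]; [Y] is squeezed between [X^T beta s] and [X^T beta t] for
    [s < U < t], and [U] avoids the countably many jumps of [beta].  Optimality
    holds level by level: [E (1_{V > t} (Y - X^T beta t))] is at most
    [E (Y - X^T beta t)_+], and the terms in [X] have the same mean. *)
Require Import Defs.
From HB Require Import structures.
From mathcomp Require Import all_boot all_order all_algebra.
From mathcomp Require Import all_classical all_reals all_analysis.
From mathcomp Require Import measurable_realfun.
From mathcomp Require Import ring lra.
Set Implicit Arguments.
Unset Strict Implicit.
Unset Printing Implicit Defensive.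
Import Order.TTheory GRing.Theory Num.Theory.
Import numFieldNormedType.Exports.
Local Open Scope classical_set_scope.
Local Open Scope ring_scope.

(** * Random vectors *)

Lemma exists_rat_dist (R : realType) (x e : R) : 0 < e ->
  exists q : rat, `|x - ratr q| < e.
Proof.
move=> e0; have /rat_in_itvoo[q] : x - e < x + e by lra.
rewrite in_itv/= => /andP[h1 h2]; exists q; rewrite ltr_norml; apply/andP; split; lra.
Qed.

Lemma exists_invS_lt (R : realType) (e : R) : 0 < e ->
  exists n : nat, n.+1%:R^-1 < e.
Proof.
move=> e0; exists (Num.bound e^-1); rewrite invf_plt ?posrE//.
apply: (lt_le_trans (archi_boundP _)); first by rewrite invr_ge0 ltW.
by rewrite ler_nat.
Qed.

Lemma measurable_forall_fin (d : measure_display) (T : measurableType d)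
    (I : finType) (A : I -> set T) :
  (forall i, measurable (A i)) -> measurable [set w | forall i, A i w].
Proof.
move=> mA; rewrite [X in measurable X](_ : _ = \bigcap_i A i).
  by apply: fin_bigcap_measurable => //; exact: finite_finset.
by apply/seteqP; split => w /= h i; [move=> _; exact: h | exact: h].
Qed.

Lemma measurable_Xbox (d : measure_display) (T : measurableType d)
    (R : realType) (p : nat) (X : T -> 'I_p -> R) (C : 'I_p -> set R) :
  random_vector X -> (forall i, measurable (C i)) -> measurable (Xbox X C).
Proof.
move=> mX mC; apply: measurable_forall_fin => i.
by rewrite -[X in measurable X]setTI; exact: mX.
Qed.

Lemma measurable_set_lt (d : measure_display) (T : measurableType d)
    (R : realType) (f g : T -> R) :
  measurable_fun setT f -> measurable_fun setT g ->
  measurable [set w | f w < g w].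
Proof.
move=> mf mg; have := measurable_fun_ltr mf mg measurableT (Y := [set true]).
by move=> /(_ I); rewrite setTI.
Qed.

Lemma measurable_set_le (d : measure_display) (T : measurableType d)
    (R : realType) (f g : T -> R) :
  measurable_fun setT f -> measurable_fun setT g ->
  measurable [set w | f w <= g w].
Proof.
move=> mf mg; have := measurable_fun_ler mf mg measurableT (Y := [set true]).
by move=> /(_ I); rewrite setTI.
Qed.

Lemma measurable_dotp (d : measure_display) (T : measurableType d)
    (R : realType) (p : nat) (X : T -> 'I_p -> R) (b : 'I_p -> R) :
  random_vector X -> measurable_fun setT (fun w => dotp (X w) b).
Proof.
move=> mX; rewrite /dotp; apply: measurable_sum => i.
by apply: measurable_funM => //; exact: mX.
Qed.

Lemma measurable_ball_vec (d : measure_display) (T : measurableType d)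
    (R : realType) (I : finType) (X : T -> I -> R) (x : I -> R) (e : R) :
  (forall i, measurable_fun setT (X ^~ i)) ->
  measurable [set w | forall i, `|X w i - x i| < e].
Proof.
move=> mX; apply: (@measurable_forall_fin _ _ _ (fun i => [set w | `|X w i - x i| <
  e])) => i.
apply: measurable_set_lt => //; apply: measurableT_comp => //.
by apply: measurable_funB => //; exact: mX.
Qed.

(** A superlevel set of a continuous [h] is open, hence the union of the countably many rational
    cubes it contains, and cubes have measurable preimages. The index type is left general so that a
    single real, or a pair of a real and a vector, also counts as a vector. *)
Lemma measurable_continuous_vec (d : measure_display) (T : measurableType d)
    (R : realType) (I : finType) (X : T -> I -> R) (h : (I -> R) -> R) :
  (forall i, measurable_fun setT (X ^~ i)) ->
  (forall (x : I -> R) (e : R), 0 < e -> exists2 dl : R, 0 < dl &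
     forall y, (forall i, `|x i - y i| < dl) -> `|h x - h y| < e) ->
  measurable_fun setT (fun w => h (X w)).
Proof.
move=> mX ch; apply: (measurability _ (RGenOInfty.measurableE R)) => //.
move=> /= _ [_ [a ->] <-]; rewrite setTI.
pose rbox (c : {ffun I -> rat} * nat) : set T :=
  [set w | forall i, `|X w i - ratr (c.1 i)| < c.2.+1%:R^-1].
pose good (c : {ffun I -> rat} * nat) :=
  `[< forall y : I -> R, (forall i, `|y i - ratr (c.1 i)| < c.2.+1%:R^-1) -> a < h y >].
rewrite [X in measurable X](_ : _ = \bigcup_c (if good c then rbox c else set0)).
  apply: countable_bigcupT_measurable => [|c]; first exact: countableP.
  by case: ifP => _ //; exact: measurable_ball_vec.
apply/seteqP; split => [w /=|w [c _]]; last first.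
  by case: ifPn => // /asboolP gc /gc /=; rewrite in_itv/= andbT.
rewrite in_itv/= andbT => ahw.
have [dl dl0 Hdl] := ch (X w) (h (X w) - a) ltac:(by rewrite subr_gt0).
have [n Hn] := @exists_invS_lt R (dl / 2) ltac:(by rewrite divr_gt0).
have n0 : 0 < n.+1%:R^-1 :> R by rewrite invr_gt0.
have /choice[q Hq] := fun i => exists_rat_dist (X w i) n0.
exists ([ffun i => q i], n) => //; rewrite ifT; last first.
  apply/asboolP => y Hy; have := Hdl y.
  rewrite ltr_norml => H; have /H/andP[h1 h2] : forall i, `|X w i - y i| < dl;
    last by move: h2; rewrite ltrD2l ltrN2.
  move=> i; have := Hy i; have := Hq i; rewrite /= ffunE => h1 h2.
  by move: Hn h1 h2; set k := _.+1%:R^-1 => ? ? ?; have :=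
    ler_distD (ratr (q i)) (X w i) (y i); rewrite (distrC (ratr _) (y i)) => ?; lra.
by move=> i /=; rewrite ffunE.
Qed.

Lemma negligible_bigcup_countType (d : measure_display) (T : measurableType d)
    (R : realType) (mu : {measure set T -> \bar R}) (C : countType) (F : C -> set T) :
  (forall c, mu.-negligible (F c)) -> mu.-negligible (\bigcup_c F c).
Proof.
move=> nF; pose G n := if unpickle n is Some c then F c else set0.
apply: (@negligibleS _ _ _ _ (\bigcup_n G n)).
  by move=> w [c _ Fcw]; exists (pickle c) => //; rewrite /G pickleK.
apply: negligible_bigcup => n; rewrite /G.
by case: unpickle => [c|]; [exact: nF|exact: negligible_set0].
Qed.

(** A point outside the support has a null neighbourhood, which contains a null rational cube around
    the point; there are only countably many such cubes. *)
Lemma ae_supportX (d : measure_display) (Om : measurableType d)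
    (R : realType) (P : probability Om R) (p : nat) (X : Om -> 'I_p -> R) :
  random_vector X -> {ae P, forall w, supportX P X (X w)}.
Proof.
move=> mX.
pose rbox (c : {ffun 'I_p -> rat} * nat) : set Om :=
  [set w | forall i, `|X w i - ratr (c.1 i)| < c.2.+1%:R^-1].
pose F c := if P (rbox c) == 0 then rbox c else set0.
apply: (@negligibleS _ _ _ _ (\bigcup_c F c)); last first.
  apply: negligible_bigcup_countType => c; rewrite /F.
  case: eqP => [P0|_]; last exact: negligible_set0.
  by apply/negligibleP => //; exact: measurable_ball_vec.
move=> w /= /existsNP[e /not_implyP[e0 /negP]]; rewrite -leNgt => He.
have [n Hn] := @exists_invS_lt R (e / 2) ltac:(by rewrite divr_gt0).
have n0 : 0 < n.+1%:R^-1 :> R by rewrite invr_gt0.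
have /choice[q Hq] := fun i => exists_rat_dist (X w i) n0.
have Hw : rbox ([ffun i => q i], n) w by move=> i /=; rewrite ffunE.
exists ([ffun i => q i], n) => //; rewrite /F ifT//.
rewrite -measure_le0; apply: le_trans He; apply: le_measure.
- by rewrite inE; exact: measurable_ball_vec.
- by rewrite inE; exact: measurable_ball_vec.
- move=> v /= Hv i; have := Hv i; have := Hw i.
  have := ler_distD (ratr ([ffun i => q i] i)) (X v i) (X w i).
  by move: Hn; rewrite /= (distrC (ratr _) (X w i)); set k := _.+1%:R^-1 => ? ? ? ?; lra.
Qed.

(** * Conditional density *)

Section conditional_density.
Context (d : measure_display) (Om : measurableType d) (R : realType)
  (P : probability Om R) (p : nat) (Y : Om -> R) (X : Om -> 'I_p -> R)
  (f : R -> ('I_p -> R) -> R).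
Hypotheses (mY : measurable_fun setT Y) (mX : random_vector X)
  (cdf : cond_density P Y X f) (bf : bounded_fun2 f) (uf : unif_cont2 f).
Local Notation leb := (@lebesgue_measure R).

Lemma measurable_density_y x : measurable_fun setT (f ^~ x).
Proof.
pose h (v : unit -> R) := f (v tt) x.
apply: (@measurable_continuous_vec _ _ R unit (fun (y : R) (_ : unit) => y) h).
  by move=> _; exact: measurable_id.
move=> v e e0; have [dl dl0 H] := uf e0; exists dl => // v' Hv.
by apply: H => // i; rewrite subrr normr0.
Qed.

Lemma integrable_density (B : set R) x : measurable B -> (leb B < +oo)%E ->
  leb.-integrable B (EFin \o f ^~ x).
Proof.
move=> mB B_fin; apply: measurable_bounded_integrable => //.
  by apply: measurable_funTS; exact: measurable_density_y.
have [M HM] := bf; exists M; split; first exact: num_real.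
by move=> N MN y _ /=; apply: (le_trans (HM _ _)); exact: ltW.
Qed.

(** The inner integral of [cond_density] as a real number, that is, the conditional probability of
    [B] given [X = x]. It is used for [B] of finite length, where boundedness of [f] gives
    integrability. *)
Definition density_mass (B : set R) (x : 'I_p -> R) : R :=
  \int[leb]_(y in B) f y x.

Lemma density_massE (B : set R) x : measurable B -> (leb B < +oo)%E ->
  (\int[leb]_(y in B) (f y x)%:E)%E = (density_mass B x)%:E.
Proof.
move=> mB B_fin; rewrite /density_mass /Rintegral fineK//.
by apply: integrable_fin_num => //; exact: integrable_density.
Qed.

Lemma density_mass_ge (B : set R) x (c : R) : measurable B ->
  (leb B < +oo)%E -> (forall y, B y -> c <= f y x) ->
  c * fine (leb B) <= density_mass B x.
Proof.
move=> mB B_fin cf; rewrite -Rintegral_cst//; apply: le_Rintegral => //.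
- by apply: measurable_bounded_integrable => //; exact: bounded_cst.
- exact: integrable_density.
Qed.

Lemma density_mass_le (B : set R) x (c : R) : measurable B ->
  (leb B < +oo)%E -> (forall y, B y -> f y x <= c) ->
  density_mass B x <= c * fine (leb B).
Proof.
move=> mB B_fin cf; rewrite -Rintegral_cst//; apply: le_Rintegral => //.
- exact: integrable_density.
- by apply: measurable_bounded_integrable => //; exact: bounded_cst.
Qed.

Lemma density_mass_continuous (B : set R) x (e : R) : measurable B ->
  (leb B < +oo)%E -> 0 < e -> exists2 dl : R, 0 < dl &
     forall x', (forall i, `|x i - x' i| < dl) ->
       `|density_mass B x - density_mass B x'| < e.
Proof.
move=> mB B_fin e0; set l := fine (leb B).
have l0 : 0 <= l by rewrite fine_ge0.
(* The [+ 1] covers sets of length zero. *)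
have e'0 : 0 < e / (l + 1) by rewrite divr_gt0// ltr_wpDl.
have [dl dl0 H] := uf e'0; exists dl => // x' Hx.
rewrite /density_mass -RintegralB//; [|exact: integrable_density..].
have iB : leb.-integrable B (EFin \o (fun y => f y x - f y x')).
  rewrite [X in _.-integrable _ X](_ : _ = (EFin \o f ^~ x) \- (EFin \o f ^~ x'))%E.
    by apply: integrableB => //; exact: integrable_density.
  by apply/funext.
apply: (le_lt_trans (le_normr_Rintegral _ iB)) => //.
apply: (@le_lt_trans _ _ (e / (l + 1) * l)).
  rewrite -Rintegral_cst//; apply: le_Rintegral => //.
  - exact: integrable_norm.
  - by apply: measurable_bounded_integrable => //; exact: bounded_cst.
  - by move=> y _; apply/ltW/H => //; rewrite subrr normr0.
rewrite mulrAC ltr_pdivrMr ?ltr_wpDl// ltr_pM2l//; lra.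
Qed.

Lemma measurable_density_mass (B : set R) : measurable B -> (leb B < +oo)%E ->
  measurable_fun setT (fun w => density_mass B (X w)).
Proof.
move=> mB B_fin; apply: measurable_continuous_vec => //.
by move=> x e; exact: density_mass_continuous.
Qed.

Lemma integrable_density_mass (B : set R) (A : set Om) : measurable B ->
  (leb B < +oo)%E -> measurable A ->
  P.-integrable A (EFin \o (fun w => density_mass B (X w))).
Proof.
move=> mB B_fin mA; apply: measurable_bounded_integrable => //.
- by rewrite (le_lt_trans (probability_le1 _ _))// ltry.
- by apply: measurable_funTS; exact: measurable_density_mass.
have [M HM] := bf; exists (M * fine (leb B)); split; first exact: num_real.
move=> N MN w _ /=; apply: le_trans (ltW MN).
rewrite ler_norml; apply/andP; split.
  rewrite -mulNr; apply: density_mass_ge => // y _.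
  by have := HM y (X w); rewrite ler_norml => /andP[].
apply: density_mass_le => // y _.
by have := HM y (X w); rewrite ler_norml => /andP[].
Qed.

Lemma measurable_preimageY (B : set R) : measurable B ->
  measurable [set w | B (Y w)].
Proof. by move=> mB; rewrite -[X in measurable X]setTI; exact: mY. Qed.

Lemma prob_box (B : set R) (C : 'I_p -> set R) : measurable B ->
  (leb B < +oo)%E -> (forall i, measurable (C i)) ->
  P ([set w | B (Y w)] `&` Xbox X C) =
  (\int[P]_(w in Xbox X C) (density_mass B (X w))%:E)%E.
Proof.
move=> mB B_fin mC; rewrite cdf//; apply: eq_integral => w _.
exact: density_massE.
Qed.

Lemma prob_box_ge (B : set R) (C : 'I_p -> set R) (c : R) : measurable B ->
  (leb B < +oo)%E -> (forall i, measurable (C i)) ->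
  (forall w, Xbox X C w -> c <= density_mass B (X w)) ->
  (c%:E * P (Xbox X C) <= P ([set w | B (Y w)] `&` Xbox X C))%E.
Proof.
move=> mB B_fin mC H; have mbox := measurable_Xbox mX mC.
rewrite prob_box// -integral_cst//; apply: le_integral => //.
- exact: finite_measure_integrable_cst.
- exact: integrable_density_mass.
- by move=> w; rewrite inE => /H; rewrite lee_fin.
Qed.

Lemma prob_box_le (B : set R) (C : 'I_p -> set R) (c : R) : measurable B ->
  (leb B < +oo)%E -> (forall i, measurable (C i)) ->
  (forall w, Xbox X C w -> density_mass B (X w) <= c) ->
  (P ([set w | B (Y w)] `&` Xbox X C) <= c%:E * P (Xbox X C))%E.
Proof.
move=> mB B_fin mC H; have mbox := measurable_Xbox mX mC.
rewrite prob_box// -integral_cst//; apply: le_integral => //.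
- exact: integrable_density_mass.
- exact: finite_measure_integrable_cst.
- by move=> w; rewrite inE => /H; rewrite lee_fin.
Qed.

Lemma measurable_hyperplane (b : 'I_p -> R) :
  measurable [set w | Y w = dotp (X w) b].
Proof.
have mZ := measurable_dotp b mX.
rewrite [X in measurable X](_ : _ =
    [set w | Y w <= dotp (X w) b] `&` [set w | dotp (X w) b <= Y w]).
  by apply: measurableI; exact: measurable_set_le.
apply/seteqP; split => w /=; first by move=> ->.
by move=> [h1 h2]; apply/eqP; rewrite eq_le h1.
Qed.

(* Cut the range of [X] into cubes of side [1/n]: on each of them the
   hyperplane lies in a strip of width [O(1/n)], whose conditional probability
   is [O(1/n)] because the density is bounded. *)
Lemma prob_hyperplane0 (b : 'I_p -> R) : P [set w | Y w = dotp (X w) b] = 0%E.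
Proof.
have [M HM] := bf; set D := [set w | _].
have mD : measurable D by exact: measurable_hyperplane.
have M0 : 0 <= M by apply: le_trans (HM 0 (fun _ => 0)).
pose L := \sum_(i < p) `|b i|.
have L0 : 0 <= L by apply: sumr_ge0.
(* The strip over one cube has length [4 * r] with [r = (L + 1) / (n + 1)], the density is at most
   [M], and the probabilities of the cubes add up to one. *)
suff bnd n : (P D <= (M * (4 * (n.+1%:R^-1 * (L + 1))))%:E)%E.
  apply/eqP; rewrite -measure_le0; apply/lee_addgt0Pr => e e0; rewrite add0e.
  have K0 : 0 < (M + 1) * (4 * (L + 1)) by rewrite mulr_gt0//; lra.
  have [n Hn] := @exists_invS_lt R (e / ((M + 1) * (4 * (L + 1)))) ltac:(by rewrite
    divr_gt0).
  apply: (le_trans (bnd n)); rewrite lee_fin.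
  move: Hn; rewrite ltr_pdivlMr//.
  have : 0 < n.+1%:R^-1 :> R by rewrite invr_gt0.
  set k := _.+1%:R^-1 => k0 Hn; apply: le_trans (ltW Hn).
  rewrite (_ : M * _ = k * (M * (4 * (L + 1)))); last by ring.
  by rewrite ler_pM2l// ler_wpM2r//; lra.
have n0 : 0 < n.+1%:R^-1 :> R by rewrite invr_gt0.
pose k (x : R) : int := Num.floor (n.+1%:R * x).
(* [kk w] labels the cube containing [X w]. Pickling the labels makes the partition a sequence [A],
   some terms of which may be empty. *)
pose kk w : {ffun 'I_p -> int} := [ffun i => k (X w i)].
pose A m := [set w | pickle (kk w) = m].
pose cell (z : int) := [set x : R | k x = z].
have mcell z : measurable (cell z).
  rewrite [cell z](_ : _ = [set x | (z%:~R <= n.+1%:R * x) ] `&` [set x | n.+1%:R *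
    x < (z + 1)%:~R]).
    apply: measurableI; [apply: measurable_set_le|apply: measurable_set_lt] => //;
    exact: mulrl_measurable.
  apply/seteqP; split => x; rewrite /cell/k/=.
    by move=> /eqP; rewrite floor_eq => /andP[].
  by move=> [h1 h2]; apply/eqP; rewrite floor_eq h1.
have AE w : A (pickle (kk w)) = Xbox X (fun i => cell (k (X w i))).
  apply/seteqP; split => v; rewrite /A/=.
    move=> /(pcan_inj pickleK) kvw i; have := congr1 (fun g : {ffun _ -> _} => g i) kvw.
    by rewrite /kk !ffunE.
  by move=> Hv; congr pickle; apply/ffunP => i; rewrite !ffunE; exact: Hv.
have mA m : measurable (A m).
  have [->|/set0P[w Aw]] := eqVneq (A m) set0; first exact: measurable0.
  by rewrite -Aw AE; exact: measurable_Xbox.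
have tA : trivIset setT A.
  by move=> i j _ _ [w []]; rewrite /A/= => -> ->.
have cA : \bigcup_m A m = setT.
  by apply/seteqP; split => // w _; exists (pickle (kk w)).
have : P D = (\big[+%E/0]_(0 <= i <oo | i \in setT) P (D `&` A i))%E.
  rewrite -measure_bigcup; last 2 first.
  - by move=> i _; exact: measurableI.
  - by apply: trivIset_setIl.
  by rewrite -setI_bigcupr cA setIT.
move=> ->; set c := M * _.
have c0 : 0 <= c by rewrite /c !mulr_ge0// ?(ltW n0)// addr_ge0.
apply: (@le_trans _ _ (\big[+%E/0]_(0 <= i <oo | i \in [set: nat]) (c%:E * P (A i)))%E).
  apply: lee_nneseries => // m _.
  have [->|/set0P[w Aw]] := eqVneq (A m) set0.
    by rewrite setI0 measure0 mule0.
  rewrite -Aw AE; set C := (fun i => _).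
  have mC i : measurable (C i) by exact: mcell.
  have mbox : measurable (Xbox X C) by exact: measurable_Xbox.
  set r := n.+1%:R^-1 * (L + 1).
  have r0 : 0 < r by rewrite mulr_gt0//; lra.
  (* Over the cube [dotp (X v) b] moves by at most [L / (n + 1)], which is less than [2 * r], so an
     open interval suffices. *)
  pose J : set R := `](dotp (X w) b - 2 * r), (dotp (X w) b + 2 * r)[%classic.
  have mJ : measurable J by exact: measurable_itv.
  have lJ : leb J = (4 * r)%:E.
    rewrite /J lebesgue_measure_itv/= lte_fin ifT; last by lra.
    by rewrite -EFinB; congr EFin; lra.
  have J_fin : (leb J < +oo)%E by rewrite lJ ltry.
  apply: (@le_trans _ _ (P ([set w | J (Y w)] `&` Xbox X C))).
    apply: le_measure; rewrite ?inE.
    - exact: measurableI.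
    - by apply: measurableI => //; exact: measurable_preimageY.
    - move=> v [Dv Cv]; split => //; rewrite /J/= in_itv/= Dv.
      have Hd : `|dotp (X v) b - dotp (X w) b| <= n.+1%:R^-1 * L.
        rewrite /dotp -sumrB; apply: (le_trans (ler_norm_sum _ _ _)).
        rewrite /L mulr_sumr; apply: ler_sum => i _; rewrite -mulrBl normrM.
        apply: ler_wpM2r => //; have := Cv i; rewrite /C/cell/=/k => E.
        have := floor_itv (n.+1%:R * X v i); have := floor_itv (n.+1%:R * X w i).
        rewrite E; move: (Num.floor _) => z /andP[h1 h2] /andP[h3 h4].
        have : `|n.+1%:R * X v i - n.+1%:R * X w i| <= 1.
          by move: h2 h4; rewrite intrD /= => h2 h4; rewrite ler_norml; apply/andP;
            split; lra.
        by rewrite -mulrBr normrM ger0_norm// -ler_pdivlMl// mulr1.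
      have : n.+1%:R^-1 * L <= r by rewrite /r ler_pM2l//; lra.
      move: Hd; rewrite ler_norml; set u := _ * L => /andP[h1 h2] h3.
      by apply/andP; split; lra.
  apply: prob_box_le => // v _.
  rewrite /c -[4 * _]/(fine (4 * r)%:E) -lJ; apply: density_mass_le => // y _.
  by have := HM y (X v); rewrite ler_norml => /andP[].
rewrite nneseriesZl// -measure_bigcup// cA.
by rewrite [X in (_ * X)%E](@probability_setT _ _ _ P) mule1.
Qed.

End conditional_density.

(** * The conditional density at points of the support *)

Lemma dotpBr (R : realType) (p : nat) (x b b' : 'I_p -> R) :
  dotp x (fun i => b i - b' i) = dotp x b - dotp x b'.
Proof. by rewrite /dotp -sumrB; apply: eq_bigr => i _; rewrite mulrBr. Qed.

Lemma dotp_continuous (R : realType) (p : nat) (x b : 'I_p -> R) (e : R) :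
  0 < e -> exists2 dl : R, 0 < dl &
    forall y, (forall i, `|y i - x i| < dl) -> `|dotp y b - dotp x b| < e.
Proof.
move=> e0; pose L := \sum_(i < p) `|b i|.
have L0 : 0 <= L by apply: sumr_ge0.
have L1 : 0 < L + 1 by lra.
exists (e / (L + 1)); first by rewrite divr_gt0.
move=> y Hy; apply: (@le_lt_trans _ _ (e / (L + 1) * L)).
  rewrite /dotp -sumrB; apply: (le_trans (ler_norm_sum _ _ _)).
  rewrite /L mulr_sumr; apply: ler_sum => i _; rewrite -mulrBl normrM.
  by apply: ler_wpM2r => //; exact/ltW/Hy.
by rewrite mulrAC ltr_pdivrMr// ltr_pM2l//; lra.
Qed.

Section density_on_support.
Context (d : measure_display) (Om : measurableType d) (R : realType)
  (P : probability Om R) (p : nat) (Y : Om -> R) (X : Om -> 'I_p -> R)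
  (f : R -> ('I_p -> R) -> R).
Hypotheses (mY : measurable_fun setT Y) (mX : random_vector X)
  (cdf : cond_density P Y X f) (bf : bounded_fun2 f) (uf : unif_cont2 f).
Local Notation leb := (@lebesgue_measure R).

Lemma measurable_cube (x : 'I_p -> R) (e : R) i :
  measurable [set z : R | `|z - x i| < e].
Proof.
apply: measurable_set_lt => //; apply: measurableT_comp => //.
exact: measurable_funB.
Qed.

Lemma lebesgue_itvoo (a b : R) : a < b -> leb `]a, b[%classic = (b - a)%:E.
Proof. by move=> ab; rewrite lebesgue_measure_itv/= lte_fin ab -EFinB. Qed.

(** [cond_density] constrains [f] only through integrals. By continuity a negative value would
    persist near [(y, x)], and a box of that neighbourhood would get negative probability, since the
    cube around [x] is charged. *)
Lemma density_ge0 x y : supportX P X x -> 0 <= f y x.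
Proof.
move=> sx; rewrite leNgt; apply/negP => fneg.
have c0 : 0 < - f y x / 2 by rewrite divr_gt0// oppr_gt0.
have [dl dl0 H] := uf c0.
pose B : set R := `](y - dl), (y + dl)[%classic.
have lB : leb B = (2 * dl)%:E.
  by rewrite /B lebesgue_itvoo; [congr EFin|]; lra.
have mB : measurable B by exact: measurable_itv.
pose C (i : 'I_p) := [set z : R | `|z - x i| < dl].
have mC i : measurable (C i) by exact: measurable_cube.
have := @prob_box_le _ _ _ _ _ _ _ _ mX cdf bf uf B C (f y x / 2 * (2 * dl)).
rewrite lB ltry => /(_ mB isT mC) HP.
have {}HP : (P ([set w | B (Y w)] `&` Xbox X C) <= (f y x / 2 * (2 * dl))%:E * P
  (Xbox X C))%E.
  apply: HP => w Cw; rewrite -[2 * dl]/(fine (2 * dl)%:E) -lB.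
  apply: density_mass_le => //; first by rewrite lB ltry.
  move=> y'; rewrite /B/= in_itv/= => /andP[h1 h2].
  have : `|f y x - f y' (X w)| < - f y x / 2.
    apply: H; first by rewrite ltr_norml; apply/andP; split; lra.
    by move=> i; rewrite distrC; exact: Cw.
  by rewrite ltr_norml => /andP[? ?]; lra.
have PC : (0 < P (Xbox X C))%E by exact: sx.
have : (0 <= P ([set w | B (Y w)] `&` Xbox X C))%E by [].
move=> /le_trans/(_ HP); apply/negP; rewrite -ltNge.
by rewrite mule_lt0_gt0// lte_fin; nra.
Qed.

(** A mass above 1 would persist on a cube around [x], and the joint event would be more likely than
    the cube itself. *)
Lemma density_mass_le1 (B : set R) x : measurable B -> (leb B < +oo)%E ->
  supportX P X x -> density_mass f B x <= 1.
Proof.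
move=> mB B_fin sx; rewrite leNgt; apply/negP => m1.
set c := (density_mass f B x - 1) / 2; have c0 : 0 < c by rewrite /c; lra.
have [dl dl0 H] := density_mass_continuous bf uf x mB B_fin c0.
pose C (i : 'I_p) := [set z : R | `|z - x i| < dl].
have mC i : measurable (C i) by exact: measurable_cube.
have HP : ((1 + c)%:E * P (Xbox X C) <= P ([set w | B (Y w)] `&` Xbox X C))%E.
  apply: (prob_box_ge mX cdf bf uf) => // w Cw.
  have : `|density_mass f B x - density_mass f B (X w)| < c.
    by apply: H => i; rewrite distrC; exact: Cw.
  by rewrite ltr_norml /c => /andP[? ?]; lra.
have PC : (0 < P (Xbox X C))%E by exact: sx.
have : (P ([set w | B (Y w)] `&` Xbox X C) <= P (Xbox X C))%E.
  apply: le_measure; rewrite ?inE; last exact: subIsetr.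
  - by apply: measurableI; [exact: measurable_preimageY|exact: measurable_Xbox].
  - exact: measurable_Xbox.
move=> /(le_trans HP); apply/negP; rewrite -ltNge.
rewrite -[X in (X < _)%E]mul1e lte_pmul2r// ?lte_fin; first by rewrite ltrDl.
exact: fin_num_measure (measurable_Xbox mX mC).
Qed.

(** The density stays above [f y x / 2] near [(y, x)], and every cube around [x] is charged. *)
Lemma prob_near_gt0 x y : supportX P X x -> 0 < f y x ->
  exists2 r : R, 0 < r & forall a b e : R, y - r < a -> a < b -> b < y + r ->
    0 < e -> e < r ->
    (0 < P ([set w | (a < Y w < b)%R] `&` [set w | forall i, (`|X w i - x i| < e)%R]))%E.
Proof.
move=> sx fpos; have c0 : 0 < f y x / 2 by rewrite divr_gt0.
have [r r0 H] := uf c0; exists r => // a b e ya ab yb e0 er.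
pose B : set R := `]a, b[%classic.
have lB : leb B = (b - a)%:E by rewrite /B lebesgue_itvoo.
have mB : measurable B by exact: measurable_itv.
pose C (i : 'I_p) := [set z : R | `|z - x i| < e].
have mC i : measurable (C i) by exact: measurable_cube.
have := @prob_box_ge _ _ _ _ _ _ _ _ mX cdf bf uf B C (f y x / 2 * (b - a)).
rewrite lB ltry => /(_ mB isT mC) HP.
have {}HP : ((f y x / 2 * (b - a))%:E * P (Xbox X C) <= P ([set w | B (Y w)] `&`
  Xbox X C))%E.
  apply: HP => w Cw; rewrite -[b - a]/(fine (b - a)%:E) -lB.
  apply: density_mass_ge => //; first by rewrite lB ltry.
  move=> y'; rewrite /B/= in_itv/= => /andP[h1 h2].
  have : `|f y x - f y' (X w)| < f y x / 2.
    apply: H; first by rewrite ltr_norml; apply/andP; split; lra.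
    by move=> i; rewrite distrC; exact: lt_trans (Cw i) er.
  by rewrite ltr_norml => /andP[? ?]; lra.
have PC : (0 < P (Xbox X C))%E by exact: sx.
have := lt_le_trans _ HP; rewrite /B /Xbox/C/=.
under [X in X `&` _]eq_set do rewrite in_itv/=.
by apply; rewrite mule_gt0// lte_fin mulr_gt0// subr_gt0.
Qed.

Lemma measurable_slab (b b0 : 'I_p -> R) :
  measurable [set w | dotp (X w) b < Y w < dotp (X w) b0].
Proof.
rewrite [X in measurable X](_ : _ =
    [set w | dotp (X w) b < Y w] `&` [set w | Y w < dotp (X w) b0]).
  by apply: measurableI; apply: measurable_set_lt => //; exact: measurable_dotp.
by apply/seteqP; split => w /=; [move=> /andP[]|move=> [-> ->]].
Qed.

(** If the density were positive at [(dotp x b, x)], a small window of values of [Y] shifted from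
    [dotp x b] towards [dotp x b0] would be charged, although it lies in one of the two null
    slabs. *)
Lemma density_hyperplane (b b0 x : 'I_p -> R) : supportX P X x ->
  P [set w | dotp (X w) b < Y w < dotp (X w) b0] = 0%E ->
  P [set w | dotp (X w) b0 < Y w < dotp (X w) b] = 0%E ->
  dotp x b <> dotp x b0 -> f (dotp x b) x = 0.
Proof.
move=> sx P1 P2; set y := dotp x b; set y0 := dotp x b0 => ne.
apply/eqP; rewrite eq_le (density_ge0 _ sx) andbT leNgt.
apply/negP => /(prob_near_gt0 sx)[r r0 H].
(* The bound [r / 2] keeps the window inside the zone of positive density, and half the gap keeps it
   between the hyperplanes even after each of them moves by [h / 4]. *)
set h := Num.min (r / 2) (`|y0 - y| / 2).
have h0 : 0 < h.
  by rewrite lt_min !divr_gt0//= normr_gt0 subr_eq0 eq_sym; exact/eqP.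
have hr : h <= r / 2 by rewrite ge_min lexx.
have hg : h <= `|y0 - y| / 2 by rewrite ge_min lexx orbT.
have h40 : 0 < h / 4 by rewrite divr_gt0.
have [d1 d10 H1] := dotp_continuous x b h40.
have [d2 d20 H2] := dotp_continuous x b0 h40.
set e := Num.min (Num.min d1 d2) (r / 2).
have e0 : 0 < e by rewrite !lt_min d10 d20 divr_gt0.
have er : e < r by rewrite /e !gt_min; apply/orP; right; lra.
have close w : (forall i, `|X w i - x i| < e) ->
    `|dotp (X w) b - y| < h / 4 /\ `|dotp (X w) b0 - y0| < h / 4.
  move=> Hw; split.
    by apply: H1 => i; apply: (lt_le_trans (Hw i)); rewrite !ge_min lexx.
  by apply: H2 => i; apply: (lt_le_trans (Hw i)); rewrite !ge_min lexx orbT.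
have contra (m : R) (S : set Om) : `|m - y| = h -> measurable S -> P S = 0%E ->
    ~ ([set w | (m - h / 4 < Y w < m + h / 4)%R] `&`
       [set w | forall i, (`|X w i - x i| < e)%R] `<=` S).
  move=> /eqP; rewrite eqr_norml => /andP[/orP ym _] mS PS sub.
  have := H (m - h / 4) (m + h / 4) e.
  move=> /(_ ltac:(by case: ym => /eqP; lra) ltac:(lra)
             ltac:(by case: ym => /eqP; lra) e0 er).
  apply/negP; rewrite -leNgt -PS; apply: le_measure => //; rewrite inE//.
  apply: measurableI; last exact: measurable_ball_vec.
  rewrite [X in measurable X](_ : _ =
      [set w | m - h / 4 < Y w] `&` [set w | Y w < m + h / 4]).
    by apply: measurableI; exact: measurable_set_lt.
  by apply/seteqP; split => w /=; [move=> /andP[]|move=> [-> ->]].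
have [lt|gt|//] := ltgtP y y0.
- apply: (contra (y + h) _ _ (measurable_slab b b0) P1).
    by rewrite addrAC subrr add0r gtr0_norm.
  move: hg; rewrite gtr0_norm ?subr_gt0// => hg w [/= /andP[? ?] /close[]].
  by rewrite !ltr_norml => /andP[? ?] /andP[? ?]; apply/andP; split; lra.
- apply: (contra (y - h) _ _ (measurable_slab b0 b) P2).
    by rewrite addrAC subrr add0r normrN gtr0_norm.
  move: hg; rewrite ltr0_norm ?subr_lt0// => hg w [/= /andP[? ?] /close[]].
  by rewrite !ltr_norml => /andP[? ?] /andP[? ?]; apply/andP; split; lra.
Qed.

End density_on_support.

(** * First order condition *)

Section integrable_real.
Context (d : measure_display) (T : measurableType d) (R : realType)
  (mu : {measure set T -> \bar R}).
Local Notation intR g := (mu.-integrable setT (EFin \o g)).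
Implicit Types g h : T -> R.

Lemma intR_measurable g : intR g -> measurable_fun setT g.
Proof. by move=> /measurable_int /measurable_EFinP. Qed.

Lemma intR_dom g h : measurable_fun setT g -> intR h ->
  (forall w, `|g w| <= `|h w|) -> intR g.
Proof.
move=> mg ih gh; apply: le_integrable ih => //; first exact/measurable_EFinP.
by move=> w _ /=; rewrite lee_fin.
Qed.

Lemma intRD g h : intR g -> intR h -> intR (fun w => g w + h w).
Proof.
move=> ig ih; have := integrableD measurableT ig ih.
by apply: eq_integrable => // w _.
Qed.

Lemma intRB g h : intR g -> intR h -> intR (fun w => g w - h w).
Proof.
move=> ig ih; have := integrableB measurableT ig ih.
by apply: eq_integrable => // w _.
Qed.

Lemma intRZ (k : R) g : intR g -> intR (fun w => k * g w).
Proof.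
move=> ig; have := integrableZl measurableT k ig.
by apply: eq_integrable => // w _.
Qed.

Lemma intR_norm g : intR g -> intR (fun w => `|g w|).
Proof. by move=> /integrable_norm. Qed.

Lemma intR_sum (I : Type) (s : seq I) (g : I -> T -> R) :
  (forall i, intR (g i)) -> intR (fun w => \sum_(i <- s) g i w).
Proof.
move=> ig; have := integrable_sum measurableT s (fun i (_ : xpredT i) => ig i).
by apply: eq_integrable => // w _; rewrite /= sumEFin.
Qed.

Lemma intR_indic g (A : set T) : measurable A -> intR g ->
  intR (fun w => g w * \1_A w).
Proof.
move=> mA ig; apply: (intR_dom _ ig).
  by apply: measurable_funM; [exact: intR_measurable|exact: measurable_indic].
by move=> w; rewrite normrM indicE; case: (_ \in _);
  rewrite ?normr1 ?mulr1// normr0 mulr0.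
Qed.

Lemma EFin_Rintegral g : intR g ->
  (\int[mu]_w (g w)%:E)%E = (\int[mu]_w g w)%:E.
Proof. by move=> ig; rewrite /Rintegral fineK//; exact: integrable_fin_num. Qed.

Lemma Rintegral_sum (I : Type) (s : seq I) (g : I -> T -> R) :
  (forall i, intR (g i)) ->
  \int[mu]_w (\sum_(i <- s) g i w) = \sum_(i <- s) \int[mu]_w g i w.
Proof.
move=> ig; elim: s => [|i s IH].
  rewrite big_nil /Rintegral; under eq_integral do rewrite big_nil.
  by rewrite integral0.
rewrite big_cons -IH -RintegralD//; last exact: intR_sum.
by apply: eq_Rintegral => w _; rewrite big_cons.
Qed.

Lemma ae_eq_Rintegral g h : measurable_fun setT g -> measurable_fun setT h ->
  {ae mu, forall w, g w = h w} -> \int[mu]_w g w = \int[mu]_w h w.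
Proof.
move=> mg mh gh; congr fine; apply: ae_eq_integral => //; try exact/measurable_EFinP.
by apply: filterS gh => w -> _.
Qed.

Lemma Rintegral_eq0_ae g : intR g -> (forall w, 0 <= g w) ->
  \int[mu]_w g w = 0 -> {ae mu, forall w, g w = 0}.
Proof.
move=> ig g0 g00; have mg := intR_measurable ig.
have /measurable_EFinP mEg := mg.
have [/(_ _)H _] := ae_eq_integral_abs mu measurableT mEg.
have : (\int[mu]_x `|(EFin \o g) x|)%E = 0%E.
  under eq_integral do rewrite gee0_abs ?lee_fin//.
  by rewrite /= EFin_Rintegral// g00.
by move=> /H; apply: filterS => w /(_ I) [].
Qed.

End integrable_real.

Lemma expectation_Rintegral (d : measure_display) (T : measurableType d)
    (R : realType) (P : probability T R) (g : T -> R) :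
  P.-integrable setT (EFin \o g) -> 'E_P[g]%E = (\int[P]_w g w)%:E.
Proof. by move=> ig; rewrite unlock; exact: EFin_Rintegral. Qed.

(** * The check function *)

Section check_function.
Context (R : realType).
Implicit Types t z a : R.

(** The two slopes of [rho t] are [t] and [t - 1], both of absolute value below 1. *)
Lemma rho_lip t z a : 0 < t < 1 -> `|rho t (z - a) - rho t z| <= `|a|.
Proof.
move=> /andP[t0 t1]; rewrite /rho ler_norml.
have [z0|z0] := leP z 0; have [z1|z1] := leP (- z) 0;
have [z2|z2] := leP (z - a) 0; have [z3|z3] := leP (- (z - a)) 0;
rewrite ?mulr0 ?addr0 ?add0r; have [a0|a0] := leP 0 a;
rewrite ?(ger0_norm a0) ?(ltr0_norm a0); apply/andP; split; nra.
Qed.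

Lemma rho_norm t z : 0 < t < 1 -> `|rho t z| <= `|z|.
Proof.
move=> ht; have := rho_lip 0 (- z) ht; rewrite opprK add0r normrN.
by rewrite [rho t 0]/rho oppr0 maxxx !mulr0 addr0 subr0.
Qed.

(** A displacement smaller than [|z|] does not cross the kink at 0, so [rho t] is affine along
    it. *)
Lemma rho_diff t z a : 0 < t < 1 -> `|a| < `|z| ->
  rho t (z - a) - rho t z = - a * ((0 < z)%R%:R - (1 - t)).
Proof.
move=> /andP[t0 t1]; have [z0|z0] := ltP 0 z.
  rewrite (gtr0_norm z0) ltr_norml => /andP[h1 h2] /=; rewrite /rho.
  rewrite [Num.max (z - a) 0]max_l; last by lra.
  rewrite [Num.max z 0]max_l; last by lra.
  rewrite [Num.max (- (z - a)) 0]max_r; last by lra.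
  rewrite [Num.max (- z) 0]max_r; last by lra.
  by ring.
rewrite (ler0_norm z0) ltr_norml => /andP[h1 h2] /=; rewrite /rho.
rewrite [Num.max (z - a) 0]max_r; last by lra.
rewrite [Num.max z 0]max_r; last by lra.
rewrite [Num.max (- (z - a)) 0]max_l; last by lra.
rewrite [Num.max (- z) 0]max_l; last by lra.
ring.
Qed.

Lemma measurable_rho t : measurable_fun setT (rho t).
Proof.
apply: measurable_funD; apply: measurable_funM => //; exact: measurable_maxr.
Qed.

End check_function.

Section first_order_condition.
Context (d : measure_display) (Om : measurableType d) (R : realType)
  (P : probability Om R) (p : nat) (Y : Om -> R) (X : Om -> 'I_p -> R)
  (f : R -> ('I_p -> R) -> R).
Hypotheses (mY : measurable_fun setT Y) (mX : random_vector X)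
  (iY : P.-integrable setT (EFin \o Y))
  (iX2 : forall i, P.-integrable setT (EFin \o (fun w => X w i ^+ 2)))
  (cdf : cond_density P Y X f) (bf : bounded_fun2 f) (uf : unif_cont2 f).
Local Notation intR g := (P.-integrable setT (EFin \o g)).

Definition above (b : 'I_p -> R) : set Om := [set w | dotp (X w) b < Y w].

Definition first_order (t : R) (b : 'I_p -> R) : Prop := forall i,
  \int[P]_w (X w i * \1_(above b) w) = (1 - t) * \int[P]_w X w i.

Lemma measurable_above b : measurable (above b).
Proof. by apply: measurable_set_lt => //; exact: measurable_dotp. Qed.

Lemma indic_above b w : \1_(above b) w = (dotp (X w) b < Y w)%R%:R :> R.
Proof. by rewrite indicE; congr (nat_of_bool _)%:R; apply/idP/idP; rewrite inE. Qed.

Lemma integrable_cst_prob (c : R) : intR (fun _ => c).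
Proof. exact: finite_measure_integrable_cst. Qed.

Lemma integrable_X i : intR (fun w => X w i).
Proof.
apply: (intR_dom (h := fun w => 1 + X w i ^+ 2)); first exact: mX.
  by apply: intRD => //; exact: integrable_cst_prob.
move=> w; rewrite [leRHS]ger0_norm; last by rewrite addr_ge0// sqr_ge0.
by rewrite ler_norml; apply/andP; split; nra.
Qed.

Lemma integrable_XX i j : intR (fun w => X w i * X w j).
Proof.
apply: (intR_dom (h := fun w => X w i ^+ 2 + X w j ^+ 2)).
- by apply: measurable_funM; exact: mX.
- exact: intRD.
move=> w; rewrite [leRHS]ger0_norm; last by rewrite addr_ge0// sqr_ge0.
by rewrite ler_norml; apply/andP; split; nra.
Qed.

Lemma integrable_dotp b : intR (fun w => dotp (X w) b).
Proof.
apply: (@intR_sum _ _ _ _ _ _ (fun i w => X w i * b i)) => i.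
by under [X in _ \o X]eq_fun do rewrite mulrC; apply: intRZ; exact: integrable_X.
Qed.

Lemma integrable_residual b : intR (fun w => Y w - dotp (X w) b).
Proof. by apply: intRB => //; exact: integrable_dotp. Qed.

Lemma integrable_rho t (g : Om -> R) : 0 < t < 1 -> intR g ->
  intR (fun w => rho t (g w)).
Proof.
move=> t01 ig; apply: intR_dom (ig) _; last by move=> w; exact: rho_norm.
by apply: measurableT_comp; [exact: measurable_rho|exact: intR_measurable ig].
Qed.

Lemma ae_notin_hyperplane b : {ae P, forall w, Y w <> dotp (X w) b}.
Proof.
rewrite /prop_near1/= /nbhs/= /almost_everywhere.
have P0 := prob_hyperplane0 mY mX cdf bf uf b.
apply: (@negligibleS _ _ _ _ [set w | Y w = dotp (X w) b]);
  first by move=> w /= /contrapT.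
apply/negligibleP => //; exact: measurable_hyperplane.
Qed.

(* The directional derivative of the expected loss at the minimizer is
   nonnegative in every direction; it is computed by dominated convergence. *)
Lemma first_order_min t b : 0 < t < 1 ->
  (forall b', ('E_P[fun w => (rho t (Y w - dotp (X w) b))%R] <=
      'E_P[fun w => (rho t (Y w - dotp (X w) b'))%R])%E) ->
  first_order t b.
Proof.
move=> t01 bmin i; set Z := fun w => Y w - dotp (X w) b.
have iZ : intR Z by exact: integrable_residual.
have mZ := intR_measurable iZ.
pose psi w := \1_(above b) w - (1 - t).
have iXi := integrable_X i; have mA := measurable_above b.
have iXpsi : intR (fun w => X w i * psi w).
  under [X in _ \o X]eq_fun do rewrite /psi mulrBr.
  apply: intRB; first exact: intR_indic.
  by under [X in _ \o X]eq_fun do rewrite mulrC; exact: intRZ.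
(* This integral is the derivative of the expected loss along [s] times the [i]-th unit vector;
   [s = 1] and [s = -1] together give equality. *)
suff key (s : R) : 0 <= \int[P]_w (- s * (X w i * psi w)).
  have := key 1; have := key (-1).
  rewrite !RintegralZl// => h1 h2.
  have {h1 h2}: \int[P]_w (X w i * psi w) = 0 by lra.
  under eq_Rintegral do rewrite /psi mulrBr (mulrC _ (1 - t)).
  rewrite RintegralB//; [|exact: intR_indic|exact: intRZ].
  by rewrite RintegralZl// => /eqP; rewrite subr_eq0 => /eqP.
(* Difference quotient of the loss in that direction with increment [1 / (n + 1)]; its mean is
   nonnegative because [b] is a minimizer. *)
pose q (n : nat) w := n.+1%:R * (rho t (Z w - n.+1%:R^-1 * (s * X w i)) - rho t (Z w)).
have irho n : intR (fun w => rho t (Z w - n.+1%:R^-1 * (s * X w i))).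
  by apply: integrable_rho => //; apply: intRB => //; do 2 apply: intRZ.
have irho0 : intR (fun w => rho t (Z w)) by exact: integrable_rho.
have iq n : intR (q n) by apply: intRZ; exact: intRB.
have q0 n : 0 <= \int[P]_w q n w.
  rewrite /q RintegralZl//; last exact: intRB.
  rewrite mulr_ge0// RintegralB// subr_ge0.
  pose b' j := b j + n.+1%:R^-1 * s * (j == i)%:R.
  have := bmin b'; have E w : Y w - dotp (X w) b' = Z w - n.+1%:R^-1 * (s * X w i).
    rewrite /Z -addrA -opprD; congr (_ - _).
    rewrite /dotp /b'; under eq_bigr do rewrite mulrDr; rewrite big_split/=;
      congr (_ + _).
    rewrite (bigD1 i)//= big1 ?addr0; last by move=> j /negbTE ->; rewrite !mulr0.
    by rewrite eqxx mulr1 mulrC mulrA.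
  under [X in (_ <= 'E_P[X])%E -> _]eq_fun do rewrite E.
  by rewrite !expectation_Rintegral// lee_fin.
have cvg_q : {ae P, forall w, setT w ->
    (q n w)%:E @[n --> \oo] --> (- s * (X w i * psi w))%:E}.
  have := ae_notin_hyperplane b; apply: filterS => w Yw _.
  have Zw : 0 < `|Z w| by rewrite normr_gt0 subr_eq0; exact/eqP.
  (* Once the displacement is smaller than the residual, [rho_diff] applies, so the quotient is
     constant for large [n]. *)
  apply: cvg_near_cst.
  have [N HN] := @exists_invS_lt R (`|Z w| / (`|s * X w i| + 1)) ltac:(by rewrite
    divr_gt0// ltr_wpDl).
  exists N => // n /= Nn; congr EFin.
  have n0 : 0 < n.+1%:R^-1 :> R by rewrite invr_gt0.
  have nN : n.+1%:R^-1 <= N.+1%:R^-1 :> R by rewrite lef_pV2 ?posrE// ler_nat.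
  rewrite /q rho_diff//.
    rewrite mulrA mulrN mulVKf// mulNr -mulrA mulNr; congr (- (_ * (_ * _))).
    by rewrite /psi indic_above /Z subr_gt0.
  rewrite normrM (gtr0_norm n0); apply: (@le_lt_trans _ _ (n.+1%:R^-1 * (`|s * X w
    i| + 1))).
    by rewrite ler_pM2l//; lra.
  by rewrite -ltr_pdivlMr ?ltr_wpDl//; exact: le_lt_trans HN.
have idom : intR (fun w => `|s * X w i|).
  by apply: (@intR_norm _ _ _ _ (fun w => s * X w i)); exact: intRZ.
have q_dom : {ae P, forall w, forall n, setT w -> (`|(q n w)%:E| <= `|s * X w i|%:E)%E}.
  apply: aeW => w n _; rewrite lee_fin /q normrM ger0_norm//.
  have := rho_lip (Z w) (n.+1%:R^-1 * (s * X w i)) t01.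
  by rewrite [X in _ <= X]normrM ger0_norm// -ler_pdivrMl ?invr_gt0// invrK.
have [_ _ Hcvg] := dominated_convergence measurableT
  (fun n => measurable_int _ (iq n)) (measurable_int _ (intRZ (- s) iXpsi))
  cvg_q idom q_dom.
rewrite -lee_fin -EFin_Rintegral; last exact: intRZ.
apply: (cvge_to_ge Hcvg).
by apply: nearW => n; rewrite /= EFin_Rintegral// lee_fin.
Qed.

End first_order_condition.

(** * Uniqueness of the solution of the first order condition *)

Section uniqueness.
Context (d : measure_display) (Om : measurableType d) (R : realType)
  (P : probability Om R) (p : nat) (Y : Om -> R) (X : Om -> 'I_p -> R)
  (f : R -> ('I_p -> R) -> R).
Hypotheses (mY : measurable_fun setT Y) (mX : random_vector X)
  (iX2 : forall i, P.-integrable setT (EFin \o (fun w => X w i ^+ 2)))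
  (cdf : cond_density P Y X f) (bf : bounded_fun2 f) (uf : unif_cont2 f).
Local Notation intR g := (P.-integrable setT (EFin \o g)).

Definition qr_hessian (b : 'I_p -> R) : 'M[R]_(p, p) :=
  \matrix_(i < p, j < p)
    fine ('E_P[fun w => (f (dotp (X w) b) (X w) * X w i * X w j)%R])%E.

Lemma measurable_density_at b :
  measurable_fun setT (fun w => f (dotp (X w) b) (X w)).
Proof.
(* The pair formed by [dotp (X w) b] and [X w] as one vector: [None] indexes the scalar
   coordinate. *)
pose V w (o : option 'I_p) := if o is Some i then X w i else dotp (X w) b.
pose h (v : option 'I_p -> R) := f (v None) (fun i => v (Some i)).
apply: (@measurable_continuous_vec _ _ R _ V h).
  by case=> [i|]; [exact: mX|exact: measurable_dotp].
move=> v e e0; have [dl dl0 H] := uf e0; exists dl => // v' Hv.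
exact: H.
Qed.

Lemma integrable_hessian b i j :
  intR (fun w => f (dotp (X w) b) (X w) * X w i * X w j).
Proof.
have [M HM] := bf.
apply: (intR_dom (h := fun w => M * (X w i * X w j))).
- apply: measurable_funM; last exact: mX.
  by apply: measurable_funM; [exact: measurable_density_at|exact: mX].
- by apply: intRZ; exact: integrable_XX.
- move=> w; rewrite -mulrA !normrM ler_wpM2r ?mulr_ge0//.
  by apply: (le_trans (HM _ _)); exact: ler_norm.
Qed.

(** The entries of the matrix times [delta] are the means of [X_i f (X^T delta)], which vanish, and
    full rank makes the matrix invertible. *)
Lemma hessian_kernel b delta : \rank (qr_hessian b) = p ->
  {ae P, forall w, f (dotp (X w) b) (X w) * dotp (X w) delta = 0} ->
  forall i, delta i = 0.
Proof.
move=> rk H.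
have M0 : qr_hessian b *m \col_i delta i = 0.
  apply/matrixP => i k; rewrite !mxE.
  transitivity (\sum_(j < p) \int[P]_w (delta j * (f (dotp (X w) b) (X w) * X w i *
    X w j))).
    apply: eq_bigr => j _; rewrite !mxE RintegralZl//; last exact: integrable_hessian.
    by rewrite mulrC expectation_Rintegral//; exact: integrable_hessian.
  rewrite -Rintegral_sum; last by move=> j; apply: intRZ; exact: integrable_hessian.
  transitivity (\int[P]_w (0 : R)); last by rewrite Rintegral_cst// mul0r.
  apply: ae_eq_Rintegral => //.
    apply: measurable_sum => j; apply: measurable_funM => //.
    exact: intR_measurable (integrable_hessian _ _ _).
  apply: filterS H => w H.
  transitivity (X w i * (f (dotp (X w) b) (X w) * dotp (X w) delta));
    last by rewrite H mulr0.
  by rewrite /dotp !mulr_sumr; apply: eq_bigr => j _; ring.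
have U : qr_hessian b \in unitmx by rewrite -row_full_unit /row_full rk.
have := mulKmx U (\col_i delta i); rewrite M0 mulmx0 => E i.
by have := congr1 (fun A : 'cV_p => A i 0) E; rewrite !mxE.
Qed.

(* Two solutions of the first order condition differ by a [delta] for which
   [X^T delta (1_{Y > X^T b0} - 1_{Y > X^T b})] is nonnegative with mean zero.
   Hence no mass of [Y] lies between the two hyperplanes, and the density
   vanishes at [X^T b0] wherever [X^T delta != 0]. *)
Lemma first_order_unique t b b0 : \rank (qr_hessian b0) = p ->
  first_order P Y X t b0 -> first_order P Y X t b -> b = b0.
Proof.
move=> rk fb0 fb; pose delta i := b i - b0 i.
suff : forall i, delta i = 0.
  by move=> D0; apply/funext => i; apply/eqP; rewrite -subr_eq0; apply/eqP/D0.
apply: (hessian_kernel rk).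
have dE w : dotp (X w) delta = dotp (X w) b - dotp (X w) b0 by exact: dotpBr.
have mA b' : measurable (above Y X b') by exact: measurable_above.
pose k w := dotp (X w) delta * (\1_(above Y X b0) w - \1_(above Y X b) w).
pose kk j w := delta j * (X w j * \1_(above Y X b0) w - X w j * \1_(above Y X b) w).
have kE w : k w = \sum_(j < p) kk j w.
  by rewrite /k /kk /dotp mulr_suml; apply: eq_bigr => j _; ring.
have ikk j : intR (kk j).
  by apply: intRZ; apply: intRB; apply: intR_indic => //; exact: integrable_X.
have ik : intR k.
  by rewrite (_ : k = fun w => \sum_(j < p) kk j w); [exact: intR_sum|exact/funext].
have k_ge0 w : 0 <= k w.
  rewrite /k dE !indic_above; have [h1|h1] := ltP (dotp (X w) b0) (Y w);
  have [h2|h2] := ltP (dotp (X w) b) (Y w) => /=;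
  rewrite ?subrr ?mulr0 ?subr0 ?sub0r ?mulr1 ?mulrN1 ?oppr_ge0 ?subr_ge0 ?subr_le0//.
    exact: le_trans (ltW h1) h2.
  exact: le_trans (ltW h2) h1.
have k0 : \int[P]_w k w = 0.
  under eq_Rintegral do rewrite kE.
  rewrite Rintegral_sum// big1// => j _; rewrite /kk RintegralZl//; last first.
    by apply: intRB; apply: intR_indic => //; exact: integrable_X.
  rewrite RintegralB//; [|by apply: intR_indic => //; exact: integrable_X..].
  by rewrite fb0 fb subrr mulr0.
have k_ae := Rintegral_eq0_ae ik k_ge0 k0.
have mslab b1 b2 := measurable_slab mY mX b1 b2.
(* On each open slab [k] equals the positive gap between the hyperplanes, so the slab lies in the
   null set where [k] is nonzero. *)
have P1 : P [set w | dotp (X w) b0 < Y w < dotp (X w) b] = 0%E.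
  apply: measure_negligible => //; apply: negligibleS k_ae => w /= /andP[h1 h2] kw.
  move: kw; rewrite /k dE !indic_above h1 ltNge (ltW h2)/= subr0 mulr1.
  by move/eqP; rewrite subr_eq0 => /eqP E; move: h2; rewrite E ltNge (ltW h1).
have P2 : P [set w | dotp (X w) b < Y w < dotp (X w) b0] = 0%E.
  apply: measure_negligible => //; apply: negligibleS k_ae => w /= /andP[h1 h2] kw.
  move: kw; rewrite /k dE !indic_above h1 ltNge (ltW h2)/= sub0r mulrN1.
  move/eqP; rewrite oppr_eq0 subr_eq0 => /eqP E.
  by move: h2; rewrite -E ltNge (ltW h1).
have := ae_supportX P mX; apply: filterS => w sx; rewrite dE.
have [->|/eqP ne] := eqVneq (dotp (X w) b) (dotp (X w) b0); first by rewrite subrr mulr0.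
by rewrite (density_hyperplane mY mX cdf bf uf sx P1 P2) ?mul0r//; exact/nesym.
Qed.

End uniqueness.

(** * Representations by a uniform variable *)

Section tail_and_independence.
Context (d : measure_display) (Om : measurableType d) (R : realType)
  (P : probability Om R).
Local Notation leb := (@lebesgue_measure R).

Lemma ge0_expectation_tail (Z : Om -> R) : measurable_fun setT Z ->
  (forall w, 0 <= Z w) ->
  measurable_fun setT (fun r : R => P [set w | (r < Z w)%R]) /\
  ('E_P[Z] = \int[leb]_(r in `[0%R, +oo[) P [set w | (r < Z w)%R])%E.
Proof.
move=> mZ Z0; pose Z' : {RV P >-> R} := mfun_Sub (mem_set mZ).
have E : (fun r : R => P [set w | (r < Z w)%R]) = ccdf Z'.
  apply/funext => r; rewrite /ccdf /distribution /pushforward; congr (P _).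
  by apply/seteqP; split => w /=; rewrite in_itv/= andbT.
split; first by rewrite E; exact: ccdf_measurable.
by rewrite E; exact: (@ge0_expectation_ccdf _ _ _ P Z').
Qed.

(** The layer-cake formula turns both expectations into integrals of tail probabilities, and these
    factor for each [r]. *)
Lemma ge0_expectation_indep (Z : Om -> R) (A : set Om) :
  measurable_fun setT Z -> (forall w, 0 <= Z w) -> measurable A ->
  (forall r : R, 0 <= r -> P ([set w | (r < Z w)%R] `&` A) =
     (P [set w | (r < Z w)%R] * P A)%E) ->
  ('E_P[fun w => (Z w * \1_A w)%R] = 'E_P[Z] * P A)%E.
Proof.
move=> mZ Z0 mA HZ.
have [mt ->] := ge0_expectation_tail mZ Z0.
have [||_ ->] := @ge0_expectation_tail (fun w => Z w * \1_A w).
- by apply: measurable_funM => //; exact: measurable_indic.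
- by move=> w; rewrite mulr_ge0// indicE.
rewrite -ge0_integralZr//; last exact: measurable_funTS.
apply: eq_integral => r; rewrite inE/= in_itv/= andbT => r0.
rewrite -HZ//; congr (P _); apply/seteqP; split => w /=; rewrite indicE.
  have [Aw|nAw] := boolP (w \in A); first by rewrite mulr1; rewrite inE in Aw.
  by rewrite mulr0 ltNge r0.
by move=> [rZ Aw]; rewrite mem_set// mulr1.
Qed.

(** The positive and negative parts are treated separately: for [r >= 0] their superlevel sets are
    preimages of half-lines under [Z]. *)
Lemma expectation_indep (Z : Om -> R) (A : set Om) :
  P.-integrable setT (EFin \o Z) -> measurable A ->
  (forall C, measurable C -> P (Z @^-1` C `&` A) = (P (Z @^-1` C) * P A)%E) ->
  \int[P]_w (Z w * \1_A w) = \int[P]_w Z w * fine (P A).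
Proof.
move=> iZ mA HZ; have mZ := intR_measurable iZ.
have ip : P.-integrable setT (EFin \o (fun w => Num.max (Z w) 0)).
  apply: intR_dom (iZ) _; first exact: measurable_maxr.
  by move=> w; have [h|h] := leP (Z w) 0; rewrite ?normr0.
have im : P.-integrable setT (EFin \o (fun w => Num.max (- Z w) 0)).
  apply: intR_dom (iZ) _.
    by apply: measurable_maxr => //; exact: measurable_funN.
  by move=> w; have [h|h] := leP (- Z w) 0; rewrite ?normr0 ?normrN.
have E w : Z w = Num.max (Z w) 0 - Num.max (- Z w) 0.
  by case: leP => h1; case: leP => h2; lra.
have pA : P A = (fine (P A))%:E by rewrite fineK//; exact: fin_num_measure.
have key (Z' : Om -> R) : P.-integrable setT (EFin \o Z') -> (forall w, 0 <= Z' w) ->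
    (forall r : R, 0 <= r -> P ([set w | (r < Z' w)%R] `&` A) =
     (P [set w | (r < Z' w)%R] * P A)%E) ->
    \int[P]_w (Z' w * \1_A w) = \int[P]_w Z' w * fine (P A).
  move=> iZ' Z'0 H; have := ge0_expectation_indep (intR_measurable iZ') Z'0 mA H.
  rewrite !expectation_Rintegral//; last exact: intR_indic.
  by rewrite pA -EFinM => -[].
have keyp := key _ ip (fun w => ltac:(by rewrite le_max lexx orbT)).
have keym := key _ im (fun w => ltac:(by rewrite le_max lexx orbT)).
transitivity (\int[P]_w (Num.max (Z w) 0 * \1_A w - Num.max (- Z w) 0 * \1_A w)).
  by apply: eq_Rintegral => w _; rewrite -mulrBl -E.
rewrite RintegralB//; [|exact: intR_indic..].
rewrite keyp ?keym.
- by rewrite -mulrBl -RintegralB//; congr (_ * _); apply: eq_Rintegral => w _; rewrite -E.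
- move=> r r0.
  have -> : [set w | r < Num.max (- Z w) 0] = Z @^-1` `]-oo, (- r)[%classic.
    apply/seteqP; split => w /=; rewrite in_itv/= lt_max; first by move=> /orP[]; lra.
    by move=> h; apply/orP; left; lra.
  exact: HZ.
- move=> r r0.
  have -> : [set w | r < Num.max (Z w) 0] = Z @^-1` `]r, +oo[%classic.
    apply/seteqP; split => w /=; rewrite in_itv/= lt_max andbT; last by move=> ->.
    by move=> /orP[]//; lra.
  exact: HZ.
Qed.

Lemma uniform01_gt (V : Om -> R) t : uniform01 P V -> 0 < t < 1 ->
  P (V @^-1` `]t, +oo[) = (1 - t)%:E.
Proof.
move=> [mV uV] /andP[t0 t1]; rewrite uV//.
rewrite [X in leb X](_ : _ = `]t, 1[%classic).
  by rewrite lebesgue_itvoo.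
apply/seteqP; split => x /=; rewrite !in_itv/= ?andbT.
  by move=> [-> /andP[_ ->]].
by move=> /andP[h1 h2]; split => //; rewrite h2 (lt_trans t0).
Qed.

Lemma uniform01_ae (V : Om -> R) : uniform01 P V ->
  {ae P, forall w, 0 < V w < 1}.
Proof.
move=> [mV uV].
have mI : measurable (`]0, 1[%classic : set R) by exact: measurable_itv.
have P0 : P (V @^-1` (~` `]0, 1[%classic)) = 0%E.
  by rewrite uV; [rewrite setICl measure0|exact: measurableC].
have : P.-negligible (V @^-1` (~` `]0, 1[%classic)).
  apply/negligibleP => //; rewrite -[X in measurable X]setTI.
  by apply: mV => //; exact: measurableC.
by apply: negligibleS => w /= h; rewrite in_itv.
Qed.

End tail_and_independence.

(** * Uniqueness of the representation *)

Section representation.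
Context (d : measure_display) (Om : measurableType d) (R : realType)
  (P : probability Om R) (p : nat) (Y : Om -> R) (X : Om -> 'I_p -> R)
  (f : R -> ('I_p -> R) -> R) (beta : R -> 'I_p -> R).
Hypotheses (mY : measurable_fun setT Y) (mX : random_vector X)
  (iX2 : forall i, P.-integrable setT (EFin \o (fun w => X w i ^+ 2)))
  (cdf : cond_density P Y X f) (bf : bounded_fun2 f) (uf : unif_cont2 f)
  (rk : forall t, 0 < t < 1 -> \rank (qr_hessian P X f (beta t)) = p)
  (fo : forall t, 0 < t < 1 -> first_order P Y X t (beta t)).
Local Notation leb := (@lebesgue_measure R).

(** Mean independence of a uniform [V] tested on half-lines only. Mean independence in (ii) and full
    independence in (iii) both imply it, so [representation_unique] serves both. *)
Definition mean_indep_tails (V : Om -> R) := forall t i, 0 < t < 1 ->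
  \int[P]_w (X w i * \1_(V @^-1` `]t, +oo[) w) = (1 - t) * \int[P]_w X w i.

Lemma mean_indep_tailsP (V : Om -> R) : uniform01 P V -> mean_indep P X V ->
  mean_indep_tails V.
Proof.
move=> uV miV t i t01; have iX := integrable_X mX iX2 i.
have mV : measurable (V @^-1` `]t, +oo[).
  by rewrite -[X in measurable X]setTI; apply: uV.1.
have := miV `]t, +oo[%classic i (measurable_itv _).
rewrite uniform01_gt// !expectation_Rintegral//; last exact: intR_indic.
by rewrite -EFinM => -[->]; rewrite mulrC.
Qed.

Lemma strictly_incr01_lt (g : R -> R) s t : strictly_incr01 g ->
  0 < s < 1 -> 0 < t < 1 -> (g s < g t) = (s < t).
Proof.
move=> ig /andP[s0 s1] /andP[t0 t1]; have [st|ts|->] := ltgtP s t; last by rewrite ltxx.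
  exact: ig.
by apply/negbTE; rewrite -leNgt ltW//; exact: ig.
Qed.

Lemma representation_unique (b : R -> 'I_p -> R) (V : Om -> R) :
  uniform01 P V -> mean_indep_tails V ->
  {ae P, forall w, Y w = dotp (X w) (b (V w))} ->
  {ae P, forall w, strictly_incr01 (fun u => dotp (X w) (b u))} ->
  (forall t, 0 < t < 1 -> b t = beta t) /\
  {ae P, forall w, Utilde Y X beta w = V w}.
Proof.
move=> uV tV aeY aeI; have aeV := uniform01_ae uV.
have bE t : 0 < t < 1 -> b t = beta t.
  move=> t01; apply: (first_order_unique mY mX iX2 cdf bf uf (rk t01) (fo t01)) => i.
  have iX := integrable_X mX iX2 i.
  rewrite -tV//; apply: ae_eq_Rintegral.
  - by apply: (intR_measurable (intR_indic _ iX)); exact: measurable_above.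
  - apply: (intR_measurable (intR_indic _ iX)).
    by rewrite -[X in measurable X]setTI; apply: uV.1.
  apply: filterS3 aeY aeI aeV => w Yw Iw Vw.
  rewrite indic_above indicE Yw (strictly_incr01_lt Iw)//.
  by congr (_ * (nat_of_bool _)%:R); apply/idP/idP; rewrite inE/= in_itv/= andbT.
split => //; apply: filterS3 aeY aeI aeV => w Yw Iw Vw.
rewrite /Utilde.
(* By strict monotonicity the levels at which [Y] is above the hyperplane form exactly []0, V w[],
   whose length is [V w]. *)
transitivity (fine (\int[leb]_(t in `]0%R, 1%R[) (\1_(`]0%R, V w[%classic) t)%:E)).
  congr fine; apply: eq_integral => t; rewrite inE/= in_itv/= => t01.
  congr EFin; rewrite !indicE; congr (nat_of_bool _)%:R; apply/idP/idP; rewrite !inE/=.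
    by rewrite -bE// Yw (strictly_incr01_lt Iw)// in_itv/= => ->; case/andP: t01 => ->.
  by rewrite in_itv/= -bE// Yw (strictly_incr01_lt Iw)// => /andP[].
rewrite integral_indic//= [X in leb X](_ : _ = `]0%R, V w[%classic); last first.
  apply/seteqP; split => x /=; rewrite !in_itv/=; first by case.
  move=> /andP[-> xV]; split => //=; move: Vw => /andP[_]; exact: lt_trans.
by move: Vw => /andP[V0 _]; rewrite lebesgue_itvoo//= subr0.
Qed.

End representation.

(** * Conditional quantiles *)

Section full_mass.
Context (d : measure_display) (Om : measurableType d) (R : realType)
  (P : probability Om R) (p : nat) (Y : Om -> R) (X : Om -> 'I_p -> R)
  (f : R -> ('I_p -> R) -> R).
Hypotheses (mY : measurable_fun setT Y) (mX : random_vector X)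
  (iY : P.-integrable setT (EFin \o Y))
  (cdf : cond_density P Y X f) (bf : bounded_fun2 f) (uf : unif_cont2 f).
Local Notation leb := (@lebesgue_measure R).
Local Notation intR g := (P.-integrable setT (EFin \o g)).

(** An exhaustion of the line by sets of finite length, to which [density_mass] applies. *)
Definition centered_itv (n : nat) : set R := `](- n.+1%:R), n.+1%:R[%classic.

Lemma lebesgue_centered_itv n : (leb (centered_itv n) < +oo)%E.
Proof. by rewrite /centered_itv lebesgue_itvoo ?ltry// gtrN. Qed.

(** Markov's inequality for [|Y|] at level [n + 1], with the probability expressed through the
    density. *)
Lemma prob_centered_itv_ge n :
  n.+1%:R * (1 - \int[P]_w density_mass f (centered_itv n) (X w)) <= \int[P]_w `|Y w|.
Proof.
have mI : measurable (centered_itv n) by exact: measurable_itv.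
pose A := [set w | centered_itv n (Y w)].
have mA : measurable A by exact: measurable_preimageY.
have mT (i : 'I_p) : measurable (setT : set R) by [].
have := prob_box cdf bf uf mI (lebesgue_centered_itv n) mT.
have -> : Xbox X (fun=> setT) = setT by apply/seteqP; split.
rewrite setIT EFin_Rintegral; last first.
  by apply: (integrable_density_mass P mX bf uf) => //; exact: lebesgue_centered_itv.
rewrite -/A => PA.
have -> : 1 - \int[P]_w density_mass f (centered_itv n) (X w) = fine (P (~` A)).
  by rewrite probability_setC// PA -EFinB.
have mcA : measurable (~` A) by exact: measurableC.
rewrite -Rintegral_cst// Rintegral_mkcond; apply: le_Rintegral => //.
- rewrite /= -restrict_EFin; apply/(integrable_mkcond _ mcA).
  exact: finite_measure_integrable_cst.
- exact: intR_norm.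
move=> w _; rewrite patchE; case: ifPn => [/set_mem|_]; last exact: normr_ge0.
by rewrite /A/centered_itv/= in_itv/= => /negP; rewrite -ltr_norml -leNgt.
Qed.

(** On [A k] all masses stay below 1 by at least [1 / (k + 1)]. Markov's bound then gives
    [(n + 1) P (A k) / (k + 1) <= E |Y|] for every [n], which forces [P (A k) = 0]. *)
Lemma ae_full_mass : {ae P, forall w, forall q : R, q < 1 ->
  exists n, q < density_mass f (centered_itv n) (X w)}.
Proof.
pose A (k : nat) := [set w | forall n, density_mass f (centered_itv n) (X w) <= 1 -
  k.+1%:R^-1].
have mmass n : measurable_fun setT (fun w => density_mass f (centered_itv n) (X w)).
  by apply: (measurable_density_mass mX bf uf);
    [exact: measurable_itv|exact: lebesgue_centered_itv].
have mA k : measurable (A k).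
  rewrite [A k](_ : _ = \bigcap_n [set w | density_mass f (centered_itv n) (X w) <=
    1 - k.+1%:R^-1]).
    by apply: bigcapT_measurable => n; exact: measurable_set_le.
  by apply/seteqP; split => w /= h n; [move=> _; exact: h|exact: h].
suff PA k : P (A k) = 0%E.
  have H k : {ae P, forall w, ~ A k w}.
    by apply: (@negligibleS _ _ _ _ (A k)) => [w /= /contrapT//|];
      exact: (iffRL (negligibleP P (mA k)) (PA k)).
  have := ae_foralln H; apply: filterS => w Hw q q1.
  have [k Hk] := @exists_invS_lt R (1 - q) ltac:(by rewrite subr_gt0).
  have /existsNP[n /negP] := Hw k; rewrite -ltNge => Hn; exists n.
  by apply: lt_trans Hn; move: Hk; set z := _.+1%:R^-1 => ?; lra.
set c : R := k.+1%:R^-1; have c0 : 0 < c by rewrite invr_gt0.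
pose up w := 1 - c * \1_(A k) w.
have iup : intR up.
  apply: intRB; first exact: integrable_cst_prob.
  apply: intRZ; exact: (integrable_indic P (mA k)).
have upE : \int[P]_w up w = 1 - c * fine (P (A k)).
  rewrite RintegralB//; [|exact: integrable_cst_prob|]; last first.
    by apply: intRZ; exact: (integrable_indic P (mA k)).
  rewrite Rintegral_cst// [X in 1 * X - _](_ : _ = 1);
    last by rewrite [X in fine X](@probability_setT _ _ _ P).
  rewrite mulr1; congr (_ - _); rewrite RintegralZl//;
    last exact: (integrable_indic P (mA k)).
  by congr (_ * _); rewrite /Rintegral integral_indic// setIT.
have bnd n : n.+1%:R * (c * fine (P (A k))) <= \int[P]_w `|Y w|.
  have im : intR (fun w => density_mass f (centered_itv n) (X w)).
    by apply: (integrable_density_mass P mX bf uf) => //;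
      [exact: measurable_itv|exact: lebesgue_centered_itv].
  apply: le_trans (prob_centered_itv_ge n); rewrite ler_pM2l//.
  suff : \int[P]_w density_mass f (centered_itv n) (X w) <= \int[P]_w up w by
    rewrite upE; lra.
  (* The bound of the mass by [up] is known only on the support, hence almost everywhere; the
     minimum makes it hold pointwise without changing the integral. *)
  have imin : intR (fun w => Num.min (density_mass f (centered_itv n) (X w)) (up w)).
    apply: (intR_dom (h := fun w => `|density_mass f (centered_itv n) (X w)| + `|up w|)).
    - by apply: measurable_minr => //; exact: intR_measurable iup.
    - by apply: intRD; exact: intR_norm.
    - move=> w; rewrite [leRHS]ger0_norm; last by rewrite addr_ge0.
      by have [h|h] := leP (density_mass f (centered_itv n) (X w)) (up w);
        rewrite ?lerDl ?lerDr normr_ge0.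
  rewrite (ae_eq_Rintegral (h := fun w => Num.min (density_mass f (centered_itv n)
    (X w)) (up w))) //.
  - by apply: le_Rintegral => // w _; rewrite ge_min lexx orbT.
  - exact: intR_measurable imin.
  - have := ae_supportX P mX; apply: filterS => w sx; apply/esym/min_idPl.
    rewrite /up indicE; have [Aw|_] := boolP (w \in A k); rewrite ?mulr1 ?mulr0 ?subr0.
      by rewrite inE in Aw; exact: Aw.
    apply: (density_mass_le1 mY mX cdf bf uf _ _ sx); first exact: measurable_itv.
    exact: lebesgue_centered_itv.
have a0 : 0 <= fine (P (A k)) by rewrite fine_ge0.
apply/eqP; rewrite -(@fineK _ (P (A k))) ?fin_num_measure// eqe.
rewrite eq_le a0 andbT leNgt; apply/negP => agt0.
have ca : 0 < c * fine (P (A k)) by rewrite mulr_gt0.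
have E0 : 0 <= \int[P]_w `|Y w| by apply: Rintegral_ge0.
have [n Hn] := @exists_invS_lt R (c * fine (P (A k)) / (\int[P]_w `|Y w| + 1))
  ltac:(by rewrite divr_gt0// ltr_wpDl).
move: Hn; rewrite ltr_pdivlMr ?ltr_wpDl// -ltr_pdivlMl// ?invr_gt0// invrK.
by move=> /lt_le_trans/(_ (bnd n)); lra.
Qed.

End full_mass.

(** * Strict monotonicity of the conditional quantile function *)

Section quantile.
Context (R : realType) (p : nat) (f : R -> ('I_p -> R) -> R) (x : 'I_p -> R)
  (M : R).
Hypotheses (uf : unif_cont2 f) (fM : forall y x, `|f y x| <= M)
  (f0 : forall y, 0 <= f y x)
  (mass_le1 : forall n, density_mass f (centered_itv n) x <= 1)
  (mass_ge : forall q : R, q < 1 ->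
     exists n, q < density_mass f (centered_itv n) x).
Local Notation leb := (@lebesgue_measure R).
Let F (y : R) := (\int[leb]_(s in `]-oo, y%R]) (f s x)%:E)%E.
Let bf : bounded_fun2 f. Proof. by exists M. Qed.

Let mf (D : set R) : measurable D -> measurable_fun D (EFin \o f ^~ x).
Proof. by move=> mD; apply/measurable_EFinP/measurable_funTS;
  exact: measurable_density_y. Qed.

Let total_le1 : (\int[leb]_s (f s x)%:E <= 1)%E.
Proof.
have cvg : (\int[leb]_(s in centered_itv n) (f s x)%:E)%E @[n --> \oo] -->
    (\int[leb]_(s in \bigcup_n centered_itv n) (f s x)%:E)%E.
  apply: ge0_nondecreasing_set_cvg_integral.
  - move=> n m nm; rewrite subsetEset => y; rewrite /centered_itv/= !in_itv/=.
    have : n.+1%:R <= m.+1%:R :> R by rewrite ler_nat.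
    by move=> ? /andP[? ?]; apply/andP; split; lra.
  - by move=> n; exact: measurable_itv.
  - by move=> n; apply: mf; exact: measurable_itv.
  - by move=> n y _; rewrite lee_fin.
have E : \bigcup_n centered_itv n = [set: R].
  apply/seteqP; split => // y _; exists (Num.bound `|y|) => //.
  rewrite /centered_itv/= in_itv/= -ltr_norml.
  by apply: (lt_le_trans (archi_boundP _)) => //; rewrite ler_nat.
rewrite E in cvg; apply: (cvge_to_le cvg); apply: nearW => n.
rewrite (density_massE bf uf x (measurable_itv _) (lebesgue_centered_itv _ n)) lee_fin.
exact: mass_le1.
Qed.

Let F_split (y y' : R) : y <= y' ->
  F y' = (F y + \int[leb]_(s in `]y, y']) (f s x)%:E)%E.
Proof.
move=> yy'; rewrite /F -ge0_integral_setU//.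
- by rewrite -itv_bndbnd_setU.
- by apply: mf; exact: measurableU.
- by move=> s _; rewrite lee_fin.
- rewrite disj_set2E; apply/eqP/seteqP; split => s //=; rewrite !in_itv/=.
  by move=> [sy /andP[/lt_le_trans/(_ sy)]]; rewrite ltxx.
Qed.

Let F_le (y y' : R) : y <= y' -> (F y <= F y')%E.
Proof.
move=> yy'; rewrite (F_split yy') leeDl//; apply: integral_ge0 => s _.
by rewrite lee_fin.
Qed.

Let F_lip (y y' : R) : y <= y' -> (F y' <= F y + (M * (y' - y))%:E)%E.
Proof.
move=> yy'; rewrite (F_split yy') leeD2l//.
have l : leb `]y, y'] = (y' - y)%:E.
  rewrite lebesgue_measure_itv/= lte_fin; case: ltP => h; first by rewrite -EFinB.
  by rewrite (_ : y' = y) ?subrr//; apply/eqP; rewrite eq_le h.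
rewrite density_massE//; last by rewrite l ltry.
rewrite lee_fin -[y' - y]/(fine (y' - y)%:E) -l.
apply: density_mass_le => //; first by rewrite l ltry.
by move=> s _; exact: le_trans (ler_norm _) (fM _ _).
Qed.

(** The half-line and the centered interval are disjoint and the total mass is at most 1, so [F] is
    small far to the left. *)
Let F_center (n : nat) : (F (- n.+1%:R) + (density_mass f (centered_itv n) x)%:E <= 1)%E.
Proof.
have l := @lebesgue_centered_itv R n.
have mI : measurable (centered_itv n : set R) by exact: measurable_itv.
rewrite -density_massE// /F -ge0_integral_setU//.
- apply: le_trans total_le1; apply: ge0_subset_integral => //.
  + exact: measurableU.
  + exact: mf.
  + by move=> s _; rewrite lee_fin.
- by apply: mf; exact: measurableU.
- by move=> s _; rewrite lee_fin.
- rewrite disj_set2E; apply/eqP/seteqP; split => s //=; rewrite /centered_itv/= !in_itv/=.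
  by move=> [sy /andP[/lt_le_trans/(_ sy)]]; rewrite ltxx.
Qed.

Let F_upper (n : nat) : ((density_mass f (centered_itv n) x)%:E <= F n.+1%:R)%E.
Proof.
have l := @lebesgue_centered_itv R n.
have mI : measurable (centered_itv n : set R) by exact: measurable_itv.
rewrite -density_massE// /F; apply: ge0_subset_integral => //.
- exact: mf.
- by move=> s _; rewrite lee_fin.
- by move=> s; rewrite /centered_itv/= !in_itv/= => /andP[_ /ltW].
Qed.

(* [F] is Lipschitz, so moving a point of the level set of [t] to the left by
   [(t - s) / (M + 1)] keeps it in the level set of [s]. *)
Lemma cond_quantile_strictly_incr : strictly_incr01 (cond_quantile f x).
Proof.
move=> s t s0 st t1; rewrite /cond_quantile.
pose S (u : R) := [set y : R | (u%:E <= F y)%E].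
rewrite -/(S s) -/(S t).
have M0 : 0 <= M by apply: le_trans (fM 0 x).
(* [inf] takes a default value on sets that are empty or unbounded below, so both cases have to be
   excluded. Here a central mass above [1 - u / 2] leaves less than [u] on the left. *)
have Slb u : 0 < u -> has_lbound (S u).
  move=> u0; have [n Hn] := mass_ge (q :=
    1 - u / 2) ltac:(by rewrite ltrBlDr ltrDl divr_gt0).
  exists (- n.+1%:R) => y Sy; rewrite leNgt; apply/negP => /ltW/F_le/(le_trans Sy).
  have := F_center n; have : (0 <= F (- n.+1%:R))%E by apply: integral_ge0 => z _;
    rewrite lee_fin.
  case: (F _) => [r| |] //=; rewrite ?leye_eq// !lee_fin; lra.
have St0 : S t !=set0.
  have [n Hn] := mass_ge t1; exists n.+1%:R; rewrite /S/=.
  by apply: le_trans (F_upper n); rewrite lee_fin ltW.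
set c := (t - s) / (M + 1).
have c0 : 0 < c by rewrite divr_gt0 ?subr_gt0// ltr_wpDl.
suff : inf (S s) + c <= inf (S t) by lra.
apply: lb_le_inf => // y Sy; rewrite -lerBrDr; apply: ge_inf; first exact: Slb.
rewrite /S/=; have yc : y - c <= y by lra.
have := le_trans Sy (F_lip yc); rewrite (_ : y - (y - c) = c); last by ring.
have : (0 <= F (y - c))%E by apply: integral_ge0 => z _; rewrite lee_fin.
case: (F _) => [r| |] //=; rewrite ?leey// -EFinD !lee_fin.
have : M * c <= t - s.
  rewrite /c mulrCA ler_piMr ?subr_ge0 ?(ltW st)// ler_pdivrMr ?mul1r; lra.
lra.
Qed.

End quantile.

(** * Spanning sets and increasing functions *)

Section spanning.
Context (R : realType) (p : nat) (S : set ('I_p -> R)).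
Hypothesis S_total : forall delta : 'I_p -> R,
  (forall x, S x -> dotp x delta = 0) -> forall i, delta i = 0.

(** Induction on [k]: fewer than [p] free rows are annihilated by some nonzero vector [dl], and by
    totality some point of [S] is not orthogonal to [dl]; that point is the next row. *)
Lemma exists_free_rows k : (k <= p)%N -> exists A : 'M[R]_(k, p),
  (forall j, S (fun i => A j i)) /\ row_free A.
Proof.
elim: k => [_|k IH kp]; first by exists 0; split; [case|rewrite /row_free mxrank0].
have [A [SA fA]] := IH (ltnW kp).
have [j Hj] : exists j, col j (cokermx A) != 0.
  apply/existsP; rewrite -negb_forall; apply/negP => /forallP H.
  have : \rank (cokermx A) = 0%N.
    apply/eqP; rewrite mxrank_eq0; apply/eqP/matrixP => i j; rewrite mxE.
    by have /eqP/matrixP/(_ i 0) := H j; rewrite !mxE.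
  by rewrite mxrank_coker (eqP fA) => /eqP; rewrite subn_eq0 leqNgt kp.
set dl := col j (cokermx A) in Hj.
have Adl : A *m dl = 0 by rewrite /dl colE mulmxA mulmx_coker mul0mx.
have [x [Sx xdl]] : exists x, S x /\ dotp x (fun i => dl i 0) != 0.
  apply: contrapT => /forallNP H; move/eqP: Hj; apply; apply/matrixP => i o.
  rewrite (ord1 o) [RHS]mxE; apply: (S_total (delta := fun i => dl i 0)) => x Sx.
  by apply/eqP; apply/negPn/negP => h; apply: (H x).
exists (col_mx (\row_i x i) A); split.
  move=> l; case: (@split_ordP 1 k l) => m ->.
    rewrite (_ : (fun i => _) = x)//; apply/funext => i.
    by have := col_mxEu (\row_i0 x i0) A m i; rewrite mxE.
  rewrite (_ : (fun i => _) = (fun i => A m i)); first exact: SA.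
  by apply/funext => i; exact: (col_mxEd (\row_i0 x i0) A m i).
apply: inj_row_free => v0 E0; pose v : 'rV_(1 + k) := v0.
(* Multiplying this vanishing combination by [dl] kills the rows of [A] and isolates the coefficient
   of the new row. *)
have E : lsubmx v *m \row_i x i + rsubmx v *m A = 0.
  by rewrite -mul_row_col hsubmxK; exact: E0.
have v1 : lsubmx v = 0.
  have := congr1 (mulmx^~ dl) E; rewrite /= mulmxDl -!mulmxA Adl mulmx0 addr0 mul0mx.
  move=> /matrixP/(_ 0 0); rewrite !mxE big_ord1 !mxE.
  rewrite (_ : \sum_j0 _ = dotp x (fun i => dl i 0)); last first.
    by apply: eq_bigr => i _; rewrite !mxE.
  move=> /eqP; rewrite mulf_eq0 (negbTE xdl) orbF => /eqP H.
  by apply/matrixP => a c; rewrite (ord1 a) (ord1 c) !mxE.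
move: E; rewrite v1 mul0mx add0r => E.
have v2 : rsubmx v = 0 by apply: (row_free_inj fA); rewrite E mul0mx.
by have := hsubmxK v; rewrite v1 v2 row_mx0.
Qed.

(** The values of [dotp] at [p] free points of [S] determine the vector, through the inverse matrix.
    This transfers regularity from the functions [dotp x (beta t)] to [beta]. *)
Lemma coordinates_from_rows : exists (A C : 'M[R]_p),
  (forall j, S (fun i => A j i)) /\
  forall b i, b i = \sum_k C i k * dotp (fun l => A k l) b.
Proof.
have [A [SA fA]] := exists_free_rows (leqnn p).
have uA : A \in unitmx by rewrite -row_free_unit.
exists A, (invmx A); split => // b i.
have := mulKmx uA (\col_j b j) => /matrixP/(_ i 0); rewrite !mxE => <-.
apply: eq_bigr => k _; congr (_ * _); rewrite mxE.
by apply: eq_bigr => l _; rewrite mxE.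
Qed.

End spanning.

(** * Increasing functions on the unit interval *)

Section monotone.
Context (R : realType).
Implicit Types (g : R -> R) (t : R).

(** The part of []0, 1[] where [g] exceeds a level is an interval. *)
Lemma strictly_incr01_measurable g : strictly_incr01 g ->
  measurable_fun (`]0, 1[%classic : set R) g.
Proof.
move=> ig _; apply: (measurability _ (RGenOInfty.measurableE R)) => //.
move=> /= _ [_ [a ->] <-]; apply: is_interval_measurable.
move=> x y [] /=; rewrite !in_itv/= !andbT => /andP[x0 x1] gx [/andP[y0 y1] gy].
move=> z /andP[xz zy]; split => /=; rewrite in_itv/=.
  by rewrite (lt_le_trans x0 xz) (le_lt_trans zy y1).
rewrite andbT.
move: xz; rewrite le_eqVlt => /predU1P[<-//|xz].
by apply: (lt_trans gx); apply: ig => //; exact: le_lt_trans zy y1.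
Qed.

(** The discontinuities of an increasing function, described by its oscillation across [t] instead
    of one-sided limits. *)
Definition jump01 g : set R := [set t | 0 < t < 1 /\
  exists2 e : R, 0 < e & forall s1 s2 : R, 0 < s1 -> s1 < t -> t < s2 -> s2 < 1 ->
    e <= g s2 - g s1].

(** Each jump leaves a gap in the values of [g]; a rational chosen in the gap identifies the
    jump. *)
Lemma countable_jump01 g : strictly_incr01 g -> countable (jump01 g).
Proof.
move=> ig.
have H t : exists q : rat, jump01 g t -> forall s1 s2 : R, 0 < s1 -> s1 < t ->
    t < s2 -> s2 < 1 -> g s1 <= ratr q <= g s2.
  have [[/andP[t0 t1] [e e0 He]]|nJ] := pselect (jump01 g t); last by exists 0.
  (* [L] is the left limit at [t], and all values to the right of [t] are at least [L + e]. *)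
  pose L := sup [set g s | s in [set s | 0 < s < t]].
  have hs : has_sup [set g s | s in [set s | 0 < s < t]].
    split; first by exists (g (t / 2)), (t / 2) => //=; apply/andP; split; lra.
    exists (g ((t + 1) / 2)) => _ [s /= /andP[s0 st] <-].
    by apply/ltW/ig; lra.
  have /rat_in_itvoo[q] : L < L + e by rewrite ltrDl.
  rewrite in_itv/= => /andP[Lq qL]; exists q => _ s1 s2 s10 s1t ts2 s21.
  apply/andP; split.
    apply: le_trans (ltW Lq); apply: ub_le_sup; first exact: hs.2.
    by exists s1 => //=; rewrite s10.
  apply: (le_trans (ltW qL)); rewrite -lerBrDr; apply: ge_sup; first exact: hs.1.
  move=> _ [s /= /andP[s0 st] <-]; rewrite lerBrDr addrC -lerBrDr.
  exact: He.
have {H}[q Hq] := choice H.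
apply/countable_injP; exists (fun t => pickle (q t)) => t t'.
rewrite !inE => Jt Jt' /(pcan_inj pickleK) qE.
have lt_contra u u' : jump01 g u -> jump01 g u' -> q u = q u' -> u < u' -> False.
  move=> Ju Ju' E uu'.
  have [/andP[u0 u1] _] := Ju; have [/andP[u0' u1'] _] := Ju'.
  (* At one and two thirds of the way from [u] to [u'], [q u <= g m1 < g m2 <= q u'] contradicts the
     equality of the rationals. *)
  pose m1 := u + (u' - u) / 3; pose m2 := u + 2 * (u' - u) / 3.
  have /andP[_ h1] := Hq u Ju (u / 2) m1 ltac:(lra) ltac:(lra) ltac:(rewrite /m1;
    lra) ltac:(rewrite /m1; lra).
  have /andP[h2 _] := Hq u' Ju' m2 ((u' + 1) / 2) ltac:(rewrite /m2;
    lra) ltac:(rewrite /m2; lra) ltac:(lra) ltac:(lra).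
  have : g m1 < g m2 by apply: ig; rewrite /m1 /m2; lra.
  by rewrite E in h1; move=> /(le_lt_trans h1)/lt_le_trans/(_ h2); rewrite ltxx.
have [lt|gt|//] := ltgtP t t'; first by case: (lt_contra t t').
by case: (lt_contra t' t).
Qed.

Lemma not_jump01 g t (e : R) : 0 < t < 1 -> ~ jump01 g t -> 0 < e ->
  exists s1 s2 : R, [/\ 0 < s1, s1 < t, t < s2, s2 < 1 & g s2 - g s1 < e].
Proof.
move=> t01 nJ e0; apply: contrapT => H; apply: nJ; split => //;
  exists e => // s1 s2 h1 h2 h3 h4.
by rewrite leNgt; apply/negP => h5; apply: H; exists s1, s2.
Qed.

Lemma strictly_incr01_le g s t : strictly_incr01 g -> 0 < s -> s <= t ->
  t < 1 -> g s <= g t.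
Proof. by move=> ig s0; rewrite le_eqVlt => /predU1P[->//|st t1]; exact/ltW/ig. Qed.

(** Together with [tail_count_ge]: for [0 <= x <= n + 1], counting the integers from 1 to [n]
    strictly below [x] recovers [x] up to an error of 1. This is a discrete layer-cake formula. *)
Lemma tail_count_le (x : R) n : 0 <= x ->
  \sum_(k < n) (k.+1%:R < x)%R%:R <= x.
Proof.
move=> x0; elim: n => [|n IH]; first by rewrite big_ord0.
rewrite big_ord_recr/=; have [h|h] := ltP; last by rewrite addr0.
apply: le_trans (ltW h); rewrite -natr1 lerD2r.
rewrite -[leRHS]mulr_natl -[n in n%:R]card_ord mulr_natl -sumr_const.
by apply: ler_sum => k _; case: (_ < _).
Qed.

Lemma tail_count_ge (x : R) n : x <= n.+1%:R ->
  x - 1 <= \sum_(k < n) (k.+1%:R < x)%R%:R.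
Proof.
elim: n => [|n IH] xn; first by rewrite big_ord0 subr_le0.
have [h|h] := leP x n.+1%:R.
  by rewrite big_ord_recr/=; apply: (le_trans (IH h)); rewrite lerDl.
rewrite (eq_bigr (fun=> 1)).
  by rewrite sumr_const card_ord lerBlDr natr1.
by move=> k _; rewrite (le_lt_trans _ h)// ler_nat.
Qed.

End monotone.

(** * The rank variable *)

Section ae_inclusion.
Context (d : measure_display) (Om : measurableType d) (R : realType)
  (P : probability Om R).
Implicit Types A B : set Om.

Lemma ae_le_measure A B : measurable A -> measurable B ->
  {ae P, forall w, A w -> B w} -> (P A <= P B)%E.
Proof.
move=> mA mB AB.
have P0 : P (A `\` B) = 0%E.
  apply: measure_negligible; first exact: measurableD.
  by apply: negligibleS AB => w /= [Aw nBw] /(_ Aw).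
have : (P A <= P (B `|` (A `\` B)))%E.
  apply: le_measure; rewrite ?inE//.
    by apply: measurableU => //; exact: measurableD.
  by move=> w Aw; have [Bw|nBw] := pselect (B w); [left|right].
move=> /le_trans; apply; apply: (le_trans (measureU2 _ _ _)) => //;
  first exact: measurableD.
by rewrite [X in (_ + X)%E]P0 adde0.
Qed.

(** An almost sure inclusion between events is reversed by comparing probabilities, since the
    difference has measure zero. *)
Lemma ae_incl_measure_le A B : measurable A -> measurable B ->
  {ae P, forall w, B w -> A w} -> (P A <= P B)%E -> {ae P, forall w, A w -> B w}.
Proof.
move=> mA mB BA PAB.
have P0 : P (A `\` B) = 0%E.
  apply/eqP; rewrite -measure_le0 measureD//;
    last by rewrite (le_lt_trans (probability_le1 P mA))// ltry.
  rewrite sube_le0 (le_trans PAB)//; apply: ae_le_measure => //; first exact: measurableI.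
  by apply: filterS BA => w BA Bw; split => //; exact: BA.
apply: (@negligibleS _ _ _ _ (A `\` B)); first by move=> w /= /not_implyP.
apply/negligibleP => //; exact: measurableD.
Qed.

End ae_inclusion.

Section law_from_tails.
Context (d : measure_display) (Om : measurableType d) (R : realType)
  (P : probability Om R) (U g : Om -> R).
Hypotheses (mU : measurable_fun setT U) (ig : P.-integrable setT (EFin \o g)).
Local Notation leb := (@lebesgue_measure R).
Local Notation I01 := (`]0, 1[%classic : set R).
Let c := \int[P]_w g w.

(** Dynkin's argument from half-lines to Borel sets, for a signed weight: [g = 1] yields the law of
    [U], and [g = X_i] yields mean independence. *)
Lemma law_from_tails :
  (forall t : R, (\int[P]_(w in U @^-1` `]t, +oo[) (g w)%:E =
     c%:E * leb (`]t, +oo[ `&` I01))%E) ->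
  forall B, measurable B ->
    (\int[P]_(w in U @^-1` B) (g w)%:E = c%:E * leb (B `&` I01))%E.
Proof.
move=> tails B mB.
have mUB A : measurable A -> measurable (U @^-1` A).
  by move=> mA; rewrite -[X in measurable X]setTI; exact: mU.
have mI : measurable I01 by exact: measurable_itv.
have lI : leb I01 = 1%E by rewrite lebesgue_itvoo ?subr0.
have igS A : measurable A -> P.-integrable (U @^-1` A) (EFin \o g).
  by move=> mA; apply: integrableS ig => //; exact: mUB.
pose Q A := (\int[P]_(w in U @^-1` A) (g w)%:E = c%:E * leb (A `&` I01))%E.
have QT : Q setT by rewrite /Q preimage_setT setTI lI mule1 EFin_Rintegral.
have RG := RGenOInfty.measurableE R.
apply: (@dynkin_induction _ _ _ Q RG) => //.
- move=> _ _ [x ->] [y ->]; exists (Num.max x y).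
  by apply/seteqP; split => z /=; rewrite !in_itv/= !andbT gt_max;
    [move=> [-> ->]|move=> /andP[]].
- by move=> _ [x ->]; exact: tails.
- move=> S mS QS.
  have mcS : measurable (~` S) by exact: measurableC.
  have : (\int[P]_(w in U @^-1` S `|` U @^-1` (~` S)) (g w)%:E = c%:E)%E.
    by rewrite -preimage_setU setUCr preimage_setT EFin_Rintegral.
  rewrite integral_setU; last 4 first.
  - exact: mUB.
  - exact: mUB.
  - by apply: measurable_funS (measurable_int _ ig).
  - by rewrite disj_set2E -preimage_setI setICr preimage_set0.
  have : leb (S `&` I01) \is a fin_num.
    rewrite ge0_fin_numE// (le_lt_trans _ (ltry 1))// -lI.
    by apply: le_measure; rewrite ?inE//; exact: measurableI.
  rewrite QS /Q => lfin E.
  have -> : leb (~` S `&` I01) = (1 - leb (S `&` I01))%E.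
    rewrite setIC -setDE measureD//; first by rewrite setIC [X in (X - _)%E]lI.
    by rewrite [X in (X < _)%E]lI ltry.
  move: E lfin; move: (leb _) => [r| |]//= E _.
  move: E; have := integrable_fin_num (mUB _ mcS) (igS _ mcS).
  move: (\int[P]_(w in _) _)%E => [v| |]//= _; rewrite -!EFinM -!EFinD => -[E].
  by congr EFin; lra.
- move=> F mF tF QF.
  have tUF : trivIset setT (fun k => U @^-1` F k).
    by move=> i j _ _ [w [Fi Fj]]; apply: tF => //; exists (U w).
  rewrite /Q preimage_bigcup integral_bigcup//; last 2 first.
  - by move=> k; exact: mUB.
  - by rewrite -preimage_bigcup; apply: igS; exact: bigcupT_measurable.
  transitivity (\big[+%E/0]_(0 <= k <oo | k \in [set: nat]) (c%:E * leb (F k `&` I01)))%E.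
    rewrite -[RHS](eq_eseriesl (P := xpredT)); last by move=> k; rewrite in_setT.
    by apply: eq_eseriesr => k _; exact: QF.
  rewrite nneseriesZl//; congr (_ * _)%E.
  have mFI k : [set: nat] k -> measurable (F k `&` I01) by move=> _; exact: measurableI.
  by rewrite -(measure_bigcup leb setT _ mFI) ?setI_bigcupl//; exact: trivIset_setIr.
- exact: (eq_ind _ (fun M : set (set R) => M B) mB _ RG).
Qed.

End law_from_tails.

Section rank_variable.
Context (d : measure_display) (Om : measurableType d) (R : realType)
  (P : probability Om R) (p : nat) (Y : Om -> R) (X : Om -> 'I_p -> R)
  (f : R -> ('I_p -> R) -> R) (beta : R -> 'I_p -> R) (i0 : 'I_p).
Hypotheses (mY : measurable_fun setT Y) (mX : random_vector X)
  (X1 : forall w, X w i0 = 1)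
  (iX2 : forall i, P.-integrable setT (EFin \o (fun w => X w i ^+ 2)))
  (bf : bounded_fun2 f) (uf : unif_cont2 f)
  (rk : forall t, 0 < t < 1 -> \rank (qr_hessian P X f (beta t)) = p)
  (fo : forall t, 0 < t < 1 -> first_order P Y X t (beta t))
  (mono : forall x, supportX P X x -> strictly_incr01 (fun t => dotp x (beta t))).
Local Notation leb := (@lebesgue_measure R).
Local Notation intR g := (P.-integrable setT (EFin \o g)).
Local Notation I01 := (`]0, 1[%classic : set R).
Local Notation U := (Utilde Y X beta).

(** A vector orthogonal to the support lies in the kernel of the Hessian at any level; [1 / 2] is an
    arbitrary choice. *)
Lemma support_total (delta : 'I_p -> R) :
  (forall x, supportX P X x -> dotp x delta = 0) -> forall i, delta i = 0.
Proof.
move=> H; have h01 : 0 < (1 / 2 : R) < 1 by apply/andP; split; lra.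
apply: (hessian_kernel mX iX2 bf uf (rk h01)).
by have := ae_supportX P mX; apply: filterS => w /H ->; rewrite mulr0.
Qed.

(* The support spans, so each coordinate of [beta] is a linear combination of
   increasing functions. *)
Lemma measurable_beta i : measurable_fun I01 (fun t => beta t i).
Proof.
have [A [C [SA H]]] := coordinates_from_rows support_total.
rewrite (_ : (fun t => beta t i) = (fun t => \sum_k C i k * dotp (fun l => A k l)
  (beta t))).
  apply: measurable_sum => k; apply: measurable_funM => //.
  exact: strictly_incr01_measurable (mono (SA k)).
by apply/funext => t; exact: H.
Qed.

(** One countable set must serve all points of a possibly uncountable support. Each
    [dotp x (beta t)] is a linear combination of the [p] functions [g k], so it can jump only where
    one of them does. *)
Lemma countable_jumps : exists2 D : set R, countable D &
  forall t x, 0 < t < 1 -> ~ D t -> supportX P X x ->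
    ~ jump01 (fun t => dotp x (beta t)) t.
Proof.
have [A [C [SA H]]] := coordinates_from_rows support_total.
pose g k t := dotp (fun l => A k l) (beta t).
exists (\bigcup_k jump01 (g k)).
  by apply: bigcup_countable => // k _; exact: countable_jump01 (mono (SA k)).
move=> t x t01 nD sx [_ [e e0 He]].
pose c k := \sum_i x i * C i k.
have gE s : dotp x (beta s) = \sum_k c k * g k s.
  rewrite /dotp; under eq_bigr => i _ do rewrite (H (beta s) i) mulr_sumr.
  rewrite exchange_big/=; apply: eq_bigr => k _; rewrite /c mulr_suml.
  by apply: eq_bigr => i _; rewrite mulrA.
pose K := \sum_k `|c k|.
have K0 : 0 <= K by apply: sumr_ge0.
have e'0 : 0 < e / (K + 1) by rewrite divr_gt0// ltr_wpDl.
have nJ k : ~ jump01 (g k) t by move=> J; apply: nD; exists k.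
have Hs k := not_jump01 t01 (nJ k) e'0.
have {Hs}[s1 Hs] := choice Hs; have {Hs}[s2 Hs] := choice Hs.
move: (t01) => /andP[t0 t1].
(* [a] is the largest left point and [b] the smallest right point, so all [g k] vary little between
   them. The seeds [t / 2] and [(t + 1) / 2] keep both inside []0, 1[]. *)
pose a := \big[Num.max/(t / 2)]_k s1 k.
pose b := - \big[Num.max/(- ((t + 1) / 2))]_k (- s2 k).
have a0 : 0 < a.
  by apply: (@lt_le_trans _ _ (t / 2)); [lra|exact: bigmax_ge_id].
have at_ : a < t by apply: bigmax_lt => [|k _]; [lra|case: (Hs k)].
have tb : t < b.
  by rewrite ltrNr; apply: bigmax_lt => [|k _]; [lra|case: (Hs k) => *; lra].
have b1 : b < 1.
  rewrite ltrNl; apply: (@lt_le_trans _ _ (- ((t + 1) / 2))); [lra|exact: bigmax_ge_id].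
have := He a b a0 at_ tb b1; rewrite !gE -sumrB leNgt; apply/negP; rewrite negbK.
apply: (@le_lt_trans _ _ (K * (e / (K + 1)))).
  rewrite /K mulr_suml; apply: ler_sum => k _; rewrite -mulrBr.
  apply: (le_trans (ler_norm _)); rewrite normrM ler_wpM2l//.
  have [h1 h2 h3 h4 h5] := Hs k; have ig := mono (SA k).
  have as1 : s1 k <= a by exact: le_bigmax.
  have bs2 : b <= s2 k by rewrite lerNl; exact: (le_bigmax _ (fun k => - s2 k)).
  have q1 : g k (s1 k) <= g k a by apply: (strictly_incr01_le ig) => //; lra.
  have q2 : g k b <= g k (s2 k) by apply: (strictly_incr01_le ig) => //; lra.
  have q3 : g k a <= g k b by apply: (strictly_incr01_le ig) => //; lra.
  by rewrite ger0_norm ?subr_ge0//; move: h5 => /ltW; apply: le_trans; lra.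
by rewrite mulrCA gtr_pMr// ltr_pdivrMr ?ltr_wpDl//; lra.
Qed.

Definition below w : set R := [set t | 0 < t < 1 /\ dotp (X w) (beta t) < Y w].

(** Joint measurability in the outcome and the level makes [U], the length of the section, a random
    variable. *)
Lemma measurable_below_prod :
  measurable [set z : Om * R | below z.1 z.2].
Proof.
have mI : measurable I01 by exact: measurable_itv.
(* [beta] is controlled only on []0, 1[]; its restriction is a measurable function on the whole
   line. *)
pose bt (i : 'I_p) (t : R) := ((fun t => beta t i) \_ I01) t.
have mbt i : measurable_fun setT (bt i).
  by apply/(measurable_restrictT _ mI); exact: measurable_beta.
have m2 : measurable_fun setT (snd : Om * R -> R) by exact: measurable_snd.
have m1 : measurable_fun setT (fst : Om * R -> Om) by exact: measurable_fst.
rewrite [X in measurable X](_ : _ = [set z : Om * R | 0 < z.2] `&` [set z | z.2 < 1] `&`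
    [set z | \sum_(i < p) X z.1 i * bt i z.2 < Y z.1]).
  apply: measurableI; first by apply: measurableI; exact: measurable_set_lt.
  apply: measurable_set_lt; last exact: measurableT_comp.
  apply: measurable_sum => i; apply: measurable_funM.
    exact: (measurableT_comp (mX i) m1).
  exact: (measurableT_comp (mbt i) m2).
have E (w : Om) (t : R) : 0 < t < 1 -> \sum_(i < p) X w i * bt i t = dotp (X w) (beta t).
  by move=> t01; apply: eq_bigr => i _; rewrite /bt patchE ifT// inE/= in_itv.
apply/seteqP; split => -[w t] /=; rewrite /below/=.
  by move=> [t01 h]; rewrite E//; case/andP: t01.
by move=> [[t0 t1]]; rewrite E ?t0.
Qed.

Lemma xsection_below w : xsection [set z : Om * R | below z.1 z.2] w = below w.
Proof. by apply/seteqP; split => t; rewrite /xsection/= inE. Qed.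

Lemma measurable_below w : measurable (below w).
Proof. by rewrite -xsection_below; apply: measurable_xsection;
  exact: measurable_below_prod. Qed.

Lemma UtildeE w : U w = fine (leb (below w)).
Proof.
rewrite /Utilde; congr fine.
transitivity (\int[leb]_(t in I01) (\1_(below w) t)%:E)%E.
  apply: eq_integral => t; rewrite inE/= in_itv/= => t01; congr EFin.
  rewrite !indicE; congr (nat_of_bool _)%:R.
  by apply/idP/idP; rewrite !inE/= /below/=; [|move=> []].
rewrite integral_indic//; last exact: measurable_below.
congr (leb _); apply/seteqP; split => t /=; first by move=> [].
by rewrite /below/= in_itv/= => -[].
Qed.

Lemma measurable_Utilde : measurable_fun setT U.
Proof.
have := measurable_fun_xsection leb measurable_below_prod => /= m.
rewrite [X in measurable_fun _ X](_ : _ = (fine \o (leb \o xsection [set z : Om * R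
  | below z.1 z.2]))).
  exact: measurableT_comp m.
by apply/funext => w; rewrite UtildeE/= xsection_below.
Qed.

Lemma lebesgue_below_le1 w : (leb (below w) <= 1)%E.
Proof.
have <- : leb I01 = 1%E by rewrite lebesgue_itvoo ?subr0.
apply: le_measure; rewrite ?inE//; first exact: measurable_below.
by move=> t; rewrite /below/= in_itv/= => -[].
Qed.

Lemma EFin_Utilde w : (U w)%:E = leb (below w).
Proof.
rewrite UtildeE fineK// ge0_fin_numE//.
exact: le_lt_trans (lebesgue_below_le1 w) (ltry 1).
Qed.

Lemma Utilde_ge0 w : 0 <= U w. Proof. by rewrite UtildeE fine_ge0. Qed.

Lemma Utilde_le1 w : U w <= 1.
Proof. by rewrite -lee_fin EFin_Utilde; exact: lebesgue_below_le1. Qed.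

(** By monotonicity [below w] is an initial segment of []0, 1[] of length [U w]: it lies inside []0,
    t]] when it misses [t], and contains []0, t[] when it contains [t], which is the case of
    [Utilde_ge_below]. *)
Lemma below_lt_Utilde w t : supportX P X (X w) -> 0 < t < 1 ->
  t < U w -> dotp (X w) (beta t) < Y w.
Proof.
move=> sx /andP[t0 t1] tU; rewrite ltNge; apply/negP => Yt.
move: tU; rewrite ltNge => /negP; apply; rewrite -lee_fin EFin_Utilde.
have <- : leb `]0, t[%classic = t%:E by rewrite lebesgue_itvoo ?subr0.
apply: le_measure; rewrite ?inE//; first exact: measurable_below.
move=> s; rewrite /below/= in_itv/= => -[/andP[s0 s1] sY]; rewrite s0/=.
rewrite ltNge; apply/negP => ts; move: sY; rewrite ltNge => /negP; apply.
apply: (le_trans Yt); exact: (strictly_incr01_le (mono sx)).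
Qed.

Lemma Utilde_ge_below w t : supportX P X (X w) -> 0 < t < 1 ->
  dotp (X w) (beta t) < Y w -> t <= U w.
Proof.
move=> sx /andP[t0 t1] tY; rewrite -lee_fin EFin_Utilde.
have <- : leb `]0, t[%classic = t%:E by rewrite lebesgue_itvoo ?subr0.
apply: le_measure; rewrite ?inE//; first exact: measurable_below.
move=> s; rewrite /below/= in_itv/= => /andP[s0 st]; split.
  by rewrite s0 (lt_trans st).
by apply: lt_trans tY; exact: (mono sx).
Qed.

(** This is the first order condition for the constant component of [X]. *)
Lemma prob_above t : 0 < t < 1 -> P (above Y X (beta t)) = (1 - t)%:E.
Proof.
move=> t01; have mA := measurable_above mY mX (beta t).
have := fo t01 i0; rewrite (eq_Rintegral _ (g := \1_(above Y X (beta t)))); last first.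
  by move=> w _; rewrite X1 mul1r.
rewrite [in RHS](eq_Rintegral _ (g := cst 1)); last by move=> w _; rewrite X1.
rewrite Rintegral_cst// mul1r [X in _ * X](_ : _ = 1); last first.
  by rewrite [X in fine X](@probability_setT _ _ _ P).
rewrite mulr1 /Rintegral integral_indic// setIT => <-.
by rewrite fineK//; exact: fin_num_measure.
Qed.

Lemma measurable_Utilde_gt t : measurable [set w | t < U w].
Proof. by apply: measurable_set_lt => //; exact: measurable_Utilde. Qed.

(** On the support [U w > t] forces [Y] above the hyperplane. The converse could fail when
    [U w = t]; it follows from probabilities, since [{U > t}] almost surely contains the event at
    each level [s > t], of probability [1 - s]. *)
Lemma Utilde_gt_ae t : 0 < t < 1 ->
  {ae P, forall w, (t < U w) = (dotp (X w) (beta t) < Y w)}.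
Proof.
move=> t01; have mG := measurable_Utilde_gt t.
have mA s := measurable_above mY mX (beta s).
have aeS := ae_supportX P mX.
have GA : {ae P, forall w, t < U w -> above Y X (beta t) w}.
  by apply: filterS aeS => w sx; exact: below_lt_Utilde.
have PG : (P (above Y X (beta t)) <= P [set w | t < U w]%R)%E.
  rewrite prob_above//; apply/lee_addgt0Pr => e e0.
  move: (t01) => /andP[t0 t1].
  (* A level above [t], within [e] of it and still below 1. *)
  pose s := Num.min (t + e) ((t + 1) / 2).
  have ts : t < s by rewrite lt_min; apply/andP; split; lra.
  have s1 : s < 1 by rewrite gt_min; apply/orP; right; lra.
  have se : s <= t + e by rewrite ge_min lexx.
  have s01 : 0 < s < 1 by apply/andP; split => //; lra.
  apply: (@le_trans _ _ ((1 - s)%:E + e%:E)%E); first by rewrite -EFinD lee_fin; lra.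
  rewrite leeD2r// -prob_above//; apply: ae_le_measure => //.
  apply: filterS aeS => w sx As; apply: (lt_le_trans ts).
  exact: Utilde_ge_below.
have AG := ae_incl_measure_le (mA t) mG GA PG.
by apply: filterS2 GA AG => w h1 h2; apply/idP/idP; [exact: h1|exact: h2].
Qed.

(** The same approximation from above at the endpoint 0, where no first order condition is
    available. *)
Lemma Utilde_gt0_ae : {ae P, forall w, 0 < U w}.
Proof.
have mG := measurable_Utilde_gt 0.
have PG : (1 <= P [set w | 0 < U w]%R)%E.
  apply/lee_addgt0Pr => e e0; pose s := Num.min e (1 / 2).
  have s0 : 0 < s by rewrite lt_min; apply/andP; split; lra.
  have s1 : s < 1 by rewrite gt_min; apply/orP; right; lra.
  have se : s <= e by rewrite ge_min lexx.
  have s01 : 0 < s < 1 by rewrite s0.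
  apply: (@le_trans _ _ ((1 - s)%:E + e%:E)%E); first by rewrite -EFinD lee_fin; lra.
  rewrite leeD2r// -prob_above//; apply: ae_le_measure => //;
    first exact: measurable_above.
  have := ae_supportX P mX; apply: filterS => w sx As; apply: (lt_le_trans s0).
  exact: Utilde_ge_below.
have := @ae_incl_measure_le _ _ _ P setT _ measurableT mG.
rewrite (@probability_setT _ _ _ P) => /(_ _ PG) H.
by have := H ltac:(exact: aeW); apply: filterS => w; exact.
Qed.

Lemma Utilde_law (g : Om -> R) : intR g ->
  (forall t, 0 < t < 1 -> \int[P]_w (g w * \1_(above Y X (beta t)) w) =
     (1 - t) * \int[P]_w g w) ->
  forall B, measurable B ->
    (\int[P]_(w in U @^-1` B) (g w)%:E = (\int[P]_w g w)%:E * leb (B `&` I01))%E.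
Proof.
move=> ig tails; apply: (law_from_tails measurable_Utilde ig) => t.
have mpre : measurable (U @^-1` `]t, +oo[).
  by rewrite -[X in measurable X]setTI; exact: measurable_Utilde.
have -> : (\int[P]_(w in U @^-1` `]t, +oo[) (g w)%:E =
    (\int[P]_w (g w * \1_[set w | (t < U w)%R] w))%:E)%E.
  rewrite -EFin_Rintegral; last exact: intR_indic (measurable_Utilde_gt t) ig.
  rewrite [LHS]integral_mkcond; apply: eq_integral => w _.
  rewrite patchE indicE.
  have -> : (w \in U @^-1` `]t, +oo[) = (w \in [set w | (t < U w)%R]).
    by apply/idP/idP; rewrite !inE/= in_itv/= andbT.
  by case: ifP => _; rewrite ?mulr1 ?mulr0.
have mind : measurable_fun setT (fun w => g w * \1_[set w | t < U w] w).
  exact: intR_measurable (intR_indic (measurable_Utilde_gt t) ig).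
(* The assumption covers levels inside []0, 1[]. Below them the tail event is almost sure because
   [U > 0], and above them it is empty because [U <= 1]. *)
have [t0|t0] := leP t 0.
  have -> : `]t, +oo[ `&` I01 = I01.
    apply/seteqP; split => x /=; rewrite !in_itv/= andbT; first by case.
    by move=> /andP[x0 x1]; split; rewrite ?x0//; exact: le_lt_trans t0 x0.
  rewrite lebesgue_itvoo// subr0 mule1; congr EFin.
  apply: ae_eq_Rintegral => //; first exact: (intR_measurable ig).
  apply: filterS Utilde_gt0_ae => w Uw.
  by rewrite indicE mem_set ?mulr1//=; exact: le_lt_trans t0 Uw.
have [t1|t1] := leP 1 t.
  have -> : `]t, +oo[ `&` I01 = set0.
    apply/seteqP; split => x //=; rewrite !in_itv/= andbT => -[h /andP[_ x1]].
    by move: h; rewrite ltNge (le_trans (ltW x1) t1).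
  rewrite measure0 mule0; congr EFin; transitivity (\int[P]_w (0 : R)).
    apply: eq_Rintegral => w _; rewrite indicE memNset ?mulr0//= => tU.
    by have := lt_le_trans tU (Utilde_le1 w); rewrite ltNge t1.
  by rewrite Rintegral_cst// mul0r.
have t01 : 0 < t < 1 by rewrite t0.
have -> : `]t, +oo[ `&` I01 = `]t, 1[%classic.
  apply/seteqP; split => x /=; rewrite !in_itv/= ?andbT.
    by move=> [-> /andP[_ ->]].
  by move=> /andP[h1 h2]; split => //; rewrite h2 (lt_trans t0).
rewrite lebesgue_itvoo// -EFinM mulrC -tails//; congr EFin.
have mA := measurable_above mY mX (beta t).
apply: ae_eq_Rintegral => //; first exact: intR_measurable (intR_indic mA ig).
apply: filterS (Utilde_gt_ae t01) => w E; rewrite indic_above -E indicE.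
by congr (_ * (nat_of_bool _)%:R); apply/idP/idP; rewrite inE.
Qed.

Lemma Utilde_uniform : uniform01 P U.
Proof.
split; first exact: measurable_Utilde.
move=> B mB; have mUB : measurable (U @^-1` B).
  by rewrite -[X in measurable X]setTI; exact: measurable_Utilde.
have tails t : 0 < t < 1 -> \int[P]_w (1 * \1_(above Y X (beta t)) w) =
    (1 - t) * \int[P]_w (1 : R).
  move=> t01; have := fo t01 i0.
  under eq_Rintegral do rewrite X1.
  by under [in RHS]eq_Rintegral do rewrite X1.
have := Utilde_law (integrable_cst_prob P 1) tails mB.
rewrite (integral_cst P mUB 1%E) mul1e => ->.
rewrite Rintegral_cst// mul1r [X in (X%:E * _)%E](_ : _ = 1) ?mul1e//.
by rewrite [X in fine X](@probability_setT _ _ _ P).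
Qed.

Lemma Utilde_mean_indep : mean_indep P X U.
Proof.
move=> B i mB; have iX := integrable_X mX iX2 i.
have mUB : measurable (U @^-1` B).
  by rewrite -[X in measurable X]setTI; exact: measurable_Utilde.
have := Utilde_law iX (fun t t01 => fo t01 i) mB.
rewrite -(Utilde_uniform.2 _ mB) -expectation_Rintegral// => <-.
rewrite unlock [RHS]integral_mkcond; apply: eq_integral => w _.
by rewrite patchE indicE; case: ifP => _; rewrite ?mulr1 ?mulr0.
Qed.

Lemma Utilde_representation :
  {ae P, forall w, Y w = dotp (X w) (beta (U w))}.
Proof.
have [D cD HD] := countable_jumps.
have mD : measurable D by apply: countable_measurable cD => t; exact: measurable_set1.
have aeD : {ae P, forall w, ~ D (U w)}.
  apply: (@negligibleS _ _ _ _ (U @^-1` D)); first by move=> w /= /contrapT.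
  apply/negligibleP; first by rewrite -[X in measurable X]setTI; exact: measurable_Utilde.
  rewrite [LHS](Utilde_uniform.2 _ mD); apply: countable_lebesgue_measure0.
  by apply: sub_countable cD; apply: subset_card_le => ? [].
apply: filterS3 aeD (uniform01_ae Utilde_uniform) (ae_supportX P mX) => w nD U01 sx.
have nJ := HD _ _ U01 nD sx.
apply/eqP; rewrite -subr_eq0 -normr_le0; apply/ler_addgt0Pr => e e0; rewrite add0r.
(* Both [Y w] and [dotp (X w) (beta (U w))] lie between the values at [s1] and [s2], which differ by
   less than [e]. *)
have [s1 [s2 [h1 h2 h3 h4 h5]]] := not_jump01 U01 nJ e0.
have s101 : 0 < s1 < 1 by apply/andP; split; lra.
have s201 : 0 < s2 < 1 by apply/andP; split; lra.
have q1 := below_lt_Utilde sx s101 h2.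
have q2 : Y w <= dotp (X w) (beta s2).
  by rewrite leNgt; apply/negP => /(Utilde_ge_below sx s201); rewrite leNgt h3.
move: U01 => /andP[U0 U1].
have q3 : dotp (X w) (beta s1) <= dotp (X w) (beta (U w)).
  by apply: (strictly_incr01_le (mono sx)) => //; exact: ltW.
have q4 : dotp (X w) (beta (U w)) <= dotp (X w) (beta s2).
  by apply: (strictly_incr01_le (mono sx)) => //; exact: ltW.
by rewrite ler_norml; apply/andP; split; lra.
Qed.

End rank_variable.

(** * Optimality *)

Section layer_cake.
Context (d : measure_display) (Om : measurableType d) (R : realType)
  (P : probability Om R) (Y : Om -> R).
Hypothesis iY : P.-integrable setT (EFin \o Y).

Lemma integrable_bounded_mul (W : Om -> R) : measurable_fun setT W ->
  (forall w, 0 <= W w <= 1) -> P.-integrable setT (EFin \o (fun w => W w * Y w)).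
Proof.
move=> mW W01; apply: intR_dom iY _.
  by apply: measurable_funM => //; exact: intR_measurable iY.
move=> w; have /andP[h0 h1] := W01 w.
by rewrite normrM ger0_norm// ler_piMl.
Qed.

(** Riemann-sum form of [E (W Y) = int_0^1 E (Y 1_{W > t}) dt]: by the counting lemmas the pointwise
    error, before division by [n + 1], is at most [|Y|]. *)
Lemma layer_cake_approx (W : Om -> R) n : measurable_fun setT W ->
  (forall w, 0 <= W w <= 1) ->
  `|n.+1%:R * \int[P]_w (W w * Y w) -
    \sum_(k < n) \int[P]_w (Y w * \1_[set w | k.+1%:R / n.+1%:R < W w] w)|
  <= \int[P]_w `|Y w|.
Proof.
move=> mW W01; have iWY := integrable_bounded_mul mW W01.
have mG (k : 'I_n) : measurable [set w | k.+1%:R / n.+1%:R < W w] by exact: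
  measurable_set_lt.
have iG (k : 'I_n) : P.-integrable setT (EFin \o
    (fun w => Y w * \1_[set w | k.+1%:R / n.+1%:R < W w] w)) by exact: intR_indic.
rewrite -RintegralZl// -Rintegral_sum// -RintegralB//; [|exact: intRZ|exact: intR_sum].
have iD : P.-integrable setT (EFin \o (fun w => n.+1%:R * (W w * Y w) -
    \sum_(k < n) Y w * \1_[set w | k.+1%:R / n.+1%:R < W w] w)).
  by apply: intRB; [exact: intRZ|exact: intR_sum].
apply: (le_trans (le_normr_Rintegral _ iD)) => //.
apply: le_Rintegral => //; [exact: intR_norm|exact: intR_norm|].
move=> w _; rewrite -mulr_sumr (mulrC (W w)) mulrCA -mulrBr normrM.
have /andP[h0 h1] := W01 w; rewrite ler_piMr//.
have E : \sum_(k < n) \1_[set w | k.+1%:R / n.+1%:R < W w] w =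
    \sum_(k < n) (k.+1%:R < n.+1%:R * W w)%R%:R :> R.
  apply: eq_bigr => k _; rewrite indicE; congr (nat_of_bool _)%:R.
  by rewrite (mulrC n.+1%:R) -ltr_pdivrMr//; apply/idP/idP; rewrite inE.
rewrite E; have := @tail_count_le R (n.+1%:R * W w) n (mulr_ge0 (ler0n _ _) h0).
have := @tail_count_ge R (n.+1%:R * W w) n; rewrite ler_piMr// => /(_ isT).
by move=> h2 h3; rewrite ler_norml; apply/andP; split; lra.
Qed.

(** Comparing the two Riemann sums bounds [(n + 1) (a - b)] by [2 E |Y|] for every [n], so [a - b]
    cannot be positive. *)
Lemma le_expectation_tails (V W : Om -> R) : measurable_fun setT V ->
  measurable_fun setT W -> (forall w, 0 <= V w <= 1) ->
  (forall w, 0 <= W w <= 1) ->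
  (forall t : R, 0 < t < 1 -> \int[P]_w (Y w * \1_[set w | t < V w] w) <=
     \int[P]_w (Y w * \1_[set w | t < W w] w)) ->
  \int[P]_w (V w * Y w) <= \int[P]_w (W w * Y w).
Proof.
move=> mV mW V01 W01 H; set a := \int[P]_w (V w * Y w); set b := \int[P]_w (W w * Y w).
set c := \int[P]_w `|Y w|.
have c0 : 0 <= c by apply: Rintegral_ge0.
have bnd n : n.+1%:R * (a - b) <= 2 * c.
  have := layer_cake_approx n mV V01; have := layer_cake_approx n mW W01.
  rewrite -/a -/b -/c !ler_norml => /andP[h1 h2] /andP[h3 h4].
  have : \sum_(k < n) \int[P]_w (Y w * \1_[set w | k.+1%:R / n.+1%:R < V w] w) <=
         \sum_(k < n) \int[P]_w (Y w * \1_[set w | k.+1%:R / n.+1%:R < W w] w).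
    apply: ler_sum => k _; apply: H; rewrite divr_gt0//= ltr_pdivrMr// mul1r ltr_nat.
    by rewrite ltnS.
  by move=> h5; rewrite mulrBr; lra.
rewrite -subr_le0 leNgt; apply/negP => ab.
have K0 : 0 < 2 * c + 1 by lra.
have [n Hn] := @exists_invS_lt R ((a - b) / (2 * c + 1)) ltac:(by rewrite divr_gt0).
move: Hn; rewrite ltr_pdivlMr// -ltr_pdivlMl ?invr_gt0// invrK.
by move=> /lt_le_trans/(_ (bnd n)); lra.
Qed.

End layer_cake.

Section optimality.
Context (d : measure_display) (Om : measurableType d) (R : realType)
  (P : probability Om R) (p : nat) (Y : Om -> R) (X : Om -> 'I_p -> R)
  (f : R -> ('I_p -> R) -> R) (beta : R -> 'I_p -> R) (i0 : 'I_p).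
Hypotheses (mY : measurable_fun setT Y) (mX : random_vector X)
  (X1 : forall w, X w i0 = 1)
  (iY : P.-integrable setT (EFin \o Y))
  (iX2 : forall i, P.-integrable setT (EFin \o (fun w => X w i ^+ 2)))
  (bf : bounded_fun2 f) (uf : unif_cont2 f)
  (rk : forall t, 0 < t < 1 -> \rank (qr_hessian P X f (beta t)) = p)
  (fo : forall t, 0 < t < 1 -> first_order P Y X t (beta t))
  (mono : forall x, supportX P X x -> strictly_incr01 (fun t => dotp x (beta t))).
Local Notation U := (Utilde Y X beta).
Local Notation intR g := (P.-integrable setT (EFin \o g)).

Lemma dotp_tail (A : set Om) (c : R) b : measurable A ->
  (forall i, \int[P]_w (X w i * \1_A w) = c * \int[P]_w X w i) ->
  \int[P]_w (dotp (X w) b * \1_A w) = c * \int[P]_w dotp (X w) b.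
Proof.
move=> mA H; have iX := integrable_X mX iX2.
transitivity (\int[P]_w (\sum_(i < p) b i * (X w i * \1_A w))).
  apply: eq_Rintegral => w _; rewrite /dotp mulr_suml; apply: eq_bigr => i _.
  by rewrite mulrAC mulrC.
rewrite Rintegral_sum; last by move=> i; apply: intRZ; exact: intR_indic.
transitivity (\int[P]_w (\sum_(i < p) c * (b i * X w i))%R).
  rewrite Rintegral_sum; last by move=> i; do 2 apply: intRZ.
  apply: eq_bigr => i _; rewrite RintegralZl//; last exact: intR_indic.
  by rewrite H RintegralZl//; [rewrite RintegralZl//; ring|exact: intRZ].
under eq_Rintegral do rewrite -mulr_sumr.
rewrite RintegralZl//.
  by congr (_ * _); apply: eq_Rintegral => w _; apply: eq_bigr => i _; rewrite mulrC.
by apply: (@intR_sum _ _ _ _ _ _ (fun i w => b i * X w i)) => i; exact: intRZ.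
Qed.

Lemma tail_optimal (V : Om -> R) t : measurable_fun setT V -> 0 < t < 1 ->
  (forall i, \int[P]_w (X w i * \1_[set w | t < V w] w) = (1 - t) * \int[P]_w X w i) ->
  \int[P]_w (Y w * \1_[set w | t < V w] w) <= \int[P]_w (Y w * \1_[set w | t < U w] w).
Proof.
move=> mV t01 HV; set b := beta t.
have mG : measurable [set w | t < V w] by exact: measurable_set_lt.
have mA : measurable (above Y X b) by exact: measurable_above.
have mU : measurable [set w | t < U w].
  exact: (measurable_Utilde_gt mY mX iX2 bf uf rk mono).
have -> : \int[P]_w (Y w * \1_[set w | t < U w] w) = \int[P]_w (Y w * \1_(above Y X b) w).
  apply: ae_eq_Rintegral.
  - exact: intR_measurable (intR_indic mU iY).
  - exact: intR_measurable (intR_indic mA iY).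
  have := Utilde_gt_ae mY mX X1 iX2 bf uf rk fo mono t01.
  apply: filterS => w E; rewrite indic_above -E indicE.
  by congr (_ * (nat_of_bool _)%:R); apply/idP/idP; rewrite inE.
have ires := integrable_residual mX iY iX2 b.
have idot := integrable_dotp mX iX2 b.
(* The event [{Y > X^T b}] keeps exactly the positive part of the residual, which dominates the
   residual cut by any other event. *)
have : \int[P]_w ((Y w - dotp (X w) b) * \1_[set w | t < V w] w) <=
       \int[P]_w ((Y w - dotp (X w) b) * \1_(above Y X b) w).
  apply: le_Rintegral => //; [exact: intR_indic|exact: intR_indic|].
  move=> w _; rewrite indic_above indicE.
  have [h|h] := ltP (dotp (X w) b) (Y w); rewrite ?mulr1 ?mulr0/=.
    by case: (_ \in _); rewrite ?mulr1 ?mulr0// subr_ge0 ltW.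
  by case: (_ \in _); rewrite ?mulr1 ?mulr0// subr_le0.
under eq_Rintegral do rewrite mulrBl.
under [in leRHS]eq_Rintegral do rewrite mulrBl.
rewrite !RintegralB//; try exact: intR_indic.
by rewrite (dotp_tail b mG HV) (dotp_tail b mA (fo t01)) lerD2r.
Qed.

Lemma Utilde_optimal (V : Om -> R) : uniform01 P V -> mean_indep P X V ->
  ('E_P[fun w => (V w * Y w)%R] <= 'E_P[fun w => (U w * Y w)%R])%E.
Proof.
move=> uV miV; have mV := uV.1.
have mU : measurable_fun setT U := measurable_Utilde mY mX iX2 bf uf rk mono.
have U01 w : 0 <= U w <= 1.
  rewrite (Utilde_ge0 mY mX iX2 bf uf rk mono).
  exact: (Utilde_le1 mY mX iX2 bf uf rk mono).
(* [V] lies in []0, 1[] only almost surely; clipping it provides the pointwise bounds of the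
   layer-cake estimate. *)
pose W w := Num.max 0 (Num.min (V w) 1).
have mW : measurable_fun setT W by apply: measurable_maxr => //; exact: measurable_minr.
have W01 w : 0 <= W w <= 1.
  by rewrite /W le_max lexx/= ge_max ler01 ge_min lexx orbT.
have VW : {ae P, forall w, V w = W w}.
  apply: filterS (uniform01_ae uV) => w /andP[/ltW V0 /ltW V1].
  by rewrite /W min_l// max_r.
have -> : ('E_P[fun w => (V w * Y w)%R] = 'E_P[fun w => (W w * Y w)%R])%E.
  rewrite unlock; apply: ae_eq_integral => //.
  - by apply/measurable_EFinP; exact: measurable_funM.
  - by apply/measurable_EFinP; exact: measurable_funM.
  - by apply: filterS VW => w -> _.
rewrite !expectation_Rintegral//; [|exact: integrable_bounded_mul..].
rewrite lee_fin; apply: le_expectation_tails => // t t01.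
apply: tail_optimal => // i.
rewrite -(mean_indep_tailsP mX iX2 uV miV i t01).
have iX := integrable_X mX iX2 i.
apply: ae_eq_Rintegral.
- by apply: intR_measurable (intR_indic _ iX); exact: measurable_set_lt.
- apply: intR_measurable (intR_indic _ iX).
  by rewrite -[X in measurable X]setTI; exact: mV.
apply: filterS VW => w E; rewrite !indicE; congr (_ * (nat_of_bool _)%:R).
by apply/idP/idP; rewrite !inE/= in_itv/= andbT E.
Qed.

End optimality.

Lemma indep_mean_indep_tails (d : measure_display) (Om : measurableType d)
    (R : realType) (P : probability Om R) (p : nat) (X : Om -> 'I_p -> R)
    (V : Om -> R) : random_vector X ->
  (forall i, P.-integrable setT (EFin \o (fun w => X w i ^+ 2))) ->
  uniform01 P V -> indep_RV_vec P V X -> mean_indep_tails P X V.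
Proof.
move=> mX iX2 uV ind t i t01; have iX := integrable_X mX iX2 i.
have mB : measurable (`]t, +oo[%classic : set R) by exact: measurable_itv.
have mA : measurable (V @^-1` `]t, +oo[) by rewrite -[X in measurable X]setTI;
  exact: uV.1.
rewrite (expectation_indep iX mA); first by rewrite uniform01_gt// mulrC.
(* A box that constrains the [i]-th coordinate alone. *)
move=> C mC; pose C' (j : 'I_p) : set R := if j == i then C else setT.
have mC' j : measurable (C' j) by rewrite /C'; case: ifP.
have E : (fun w => X w i) @^-1` C = Xbox X C'.
  apply/seteqP; split => w /=; rewrite /Xbox/= /C'.
    by move=> Cw j; case: eqP => [->|].
  by move=> /(_ i); rewrite eqxx.
by rewrite E setIC (ind _ _ mB mC') muleC.
Qed.

Theorem theorem3p3 (d : measure_display) (Om : measurableType d)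
  (R : realType) (P : probability Om R) (p : nat) (hp : (0 < p)%N)
  (Y : Om -> R) (X : Om -> 'I_p -> R) (beta : R -> 'I_p -> R)
  (f : R -> ('I_p -> R) -> R) :
  (* Y scalar random variable, X random vector with first component 1 *)
  measurable_fun setT Y ->
  random_vector X ->
  (forall w, X w (Ordinal hp) = 1) ->
  (* beta(t) is a quantile regression coefficient *)
  (forall t : R, 0 < t < 1 -> forall b : 'I_p -> R,
     ('E_P[fun w => (rho t (Y w - dotp (X w) (beta t)))%R] <=
      'E_P[fun w => (rho t (Y w - dotp (X w) b))%R])%E) ->
  (* (QR) *)
  P.-integrable setT (fun w => (Y w)%:E) ->
  (forall i, P.-integrable setT (fun w => (X w i ^+ 2)%:E)) ->
  cond_density P Y X f -> bounded_fun2 f -> unif_cont2 f ->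
  (forall t : R, 0 < t < 1 ->
     \rank (\matrix_(i < p, j < p)
        fine ('E_P[fun w => (f (dotp (X w) (beta t)) (X w) * X w i * X w j)%R])%E)
     = p) ->
  let U := Utilde Y X beta in
  (* (i) *)
  ((forall x, supportX P X x -> strictly_incr01 (fun t => dotp x (beta t))) ->
     [/\ {ae P, forall w, Y w = dotp (X w) (beta (U w))},
         uniform01 P U,
         mean_indep P X U &
         forall V : Om -> R, uniform01 P V -> mean_indep P X V ->
           ('E_P[fun w => (V w * Y w)%R] <= 'E_P[fun w => (U w * Y w)%R])%E])
  /\
  (* (ii) *)
  ((forall x, supportX P X x -> strictly_incr01 (fun t => dotp x (beta t))) ->
     forall (betab : R -> 'I_p -> R) (Ub : Om -> R),
       uniform01 P Ub -> mean_indep P X Ub ->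
       {ae P, forall w, Y w = dotp (X w) (betab (Ub w))} ->
       {ae P, forall w, strictly_incr01 (fun u => dotp (X w) (betab u))} ->
       {ae P, forall w, U w = Ub w} /\
       {ae P, forall w, dotp (X w) (beta (U w)) = dotp (X w) (betab (Ub w))})
  /\
  (* (iii) *)
  (forall (beta0 : R -> 'I_p -> R),
     {ae P, forall w, forall u : R, 0 < u < 1 ->
        cond_quantile f (X w) u = dotp (X w) (beta0 u)} ->
     forall U0 : Om -> R, uniform01 P U0 -> indep_RV_vec P U0 X ->
       {ae P, forall w, Y w = dotp (X w) (beta0 (U0 w))} ->
       {ae P, forall w, U0 w = U w} /\
       {ae P, forall w, beta0 (U0 w) = beta (U0 w)}).
Proof.
move=> mY mX X1 bmin iY iX2 cdf bf uf rk U.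
have fo t : 0 < t < 1 -> first_order P Y X t (beta t).
  by move=> t01; apply: (first_order_min mY mX iY iX2 cdf bf uf t01); exact: bmin.
split=> [mono|].
  split.
  - exact: (Utilde_representation mY mX X1 iX2 bf uf rk fo mono).
  - exact: (Utilde_uniform mY mX X1 iX2 bf uf rk fo mono).
  - exact: (Utilde_mean_indep mY mX X1 iX2 bf uf rk fo mono).
  - by move=> V; exact: (Utilde_optimal mY mX X1 iY iX2 bf uf rk fo mono).
have rep := representation_unique mY mX iX2 cdf bf uf rk fo.
split=> [_ betab Ub uUb miUb YUb incr|beta0 Q U0 uU0 ind YU0].
  have [bE UE] := rep _ _ uUb (mean_indep_tailsP mX iX2 uUb miUb) YUb incr.
  split => //; apply: filterS2 UE (uniform01_ae uUb) => w UEw U01.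
  by rewrite /U UEw bE.
(* In (iii) monotonicity is derived: at almost every [w] the point [X w] is in the support and
   carries full conditional mass, so its conditional quantile function is strictly increasing. *)
have incr : {ae P, forall w, strictly_incr01 (fun u => dotp (X w) (beta0 u))}.
  have full := ae_full_mass mY mX iY cdf bf uf; have [M HM] := bf.
  apply: filterS3 full Q (ae_supportX P mX) => w full Q sx s t s0 st t1.
  have s1 := lt_trans st t1; have t0 := lt_trans s0 st.
  rewrite -!Q ?s0 ?s1 ?t0 ?t1//.
  apply: (cond_quantile_strictly_incr uf HM) => //.
  - by move=> y; exact: (density_ge0 mX cdf bf uf _ sx).
  - move=> n; apply: (density_mass_le1 mY mX cdf bf uf _ _ sx);
    first exact: measurable_itv.
    exact: lebesgue_centered_itv.
have [bE UE] := rep _ _ uU0 (indep_mean_indep_tails mX iX2 uU0 ind) YU0 incr.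
split; first by apply: filterS UE => w.
by apply: filterS (uniform01_ae uU0) => w U01; rewrite bE.
Qed.
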